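(* The problem Cut$_\ell$ has extension complexity $2^{k}n^{O(1)}$ on $n$-vertex graphs of treewidth at most $k$. Under ETH, this problem has no extended formulation with $2^{o(k)}n^{O(1)}$ inequalities.
   Context: For a graph $G$ and a partition $(A,B)$ of $V_G$, the cut-set of the partition is the set of edges with one endpoint in $A$ and the other in $B$. Cut$_\ell$ is the edge subset problem consisting of all pairs $(G,X)$ where $G$ is a graph and $X$ is a cut-set of $G$ of size at least $\ell$. For a graph $G$, the solution polytope $P_{\Pi}(G)$ is the convex hull of the 0/1 indicator vectors (indexed by $E_G$) of all solutions of $\Pi$ in $G$. A problem $\Pi$ has extension complexity $f(k,n)$ on $n$-vertex graphs of treewidth at most $k$ if for each such graph $G$, $P_{\Pi}(G)$ has extension complexity at most $f(k,n)$. $\Pi$ has no extended formulation with $g(k,n)$ inequalities if no polytope $P'$ that is an extended formulation of $P_{\Pi}(G)$ can be defined with $g(k,n)$ inequalities or fewer. *)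

(* Defs.v *)
From HB Require Import structures.
From mathcomp Require Import all_boot all_order all_algebra.
From mathcomp Require Import all_classical all_reals all_analysis.

Set Implicit Arguments.
Unset Strict Implicit.
Unset Printing Implicit Defensive.

Import Order.TTheory GRing.Theory Num.Theory.

Record sgraph := SGraph {
  vertex :> finType;
  adj : rel vertex;
  adj_sym : symmetric adj;
  adj_irr : irreflexive adj }.

Definition edges (G : sgraph) : {set {set G}} :=
  [set e : {set G} | [exists x, exists y, adj x y && (e == [set x; y])]]%SET.

Definition is_tree (I : sgraph) : Prop :=
  [/\ 0 < #|I|,
      forall i j : I, fingraph.connect (@adj I) i j
    & forall p : seq I, 2 < size p -> ~~ path.ucycleb (@adj I) p].

Definition is_tree_decomposition (G I : sgraph) (bag : I -> {set G}) : Prop :=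
  [/\ is_tree I,
      forall v : G, exists i, v \in bag i,
      forall e, e \in edges G -> exists i, e \subset bag i
    & forall (v : G) (i j : I), v \in bag i -> v \in bag j ->
        fingraph.connect
          [rel a b : I | [&& adj a b, v \in bag a & v \in bag b]] i j].

Definition treewidth_at_most (G : sgraph) (k : nat) : Prop :=
  exists (I : sgraph) (bag : I -> {set G}),
    is_tree_decomposition bag /\ forall i, #|bag i| <= k.+1.

Definition edge_subset_problem := forall G : sgraph, {set {set G}} -> Prop.

Definition cut_of (G : sgraph) (A B : {set G}) : {set {set G}} :=
  [set e in edges G |
    [exists x in A, exists y in B, e == [set x; y]]]%SET.

(* One of the two sides of the partition may be empty. *)
Definition is_cutset (G : sgraph) (X : {set {set G}}) : Prop :=
  exists A B : {set G},
    [/\ (A :|: B)%SET = [set: G]%SET, [disjoint A & B] & X = cut_of A B].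

Definition Cut (l : nat) : edge_subset_problem :=
  fun G X => is_cutset X /\ l <= #|X|.

Section Polytopes.
Local Open Scope classical_set_scope.
Local Open Scope ring_scope.
Variable R : realType.

Definition convex_hull (m : nat) (S : set 'cV[R]_m) : set 'cV[R]_m :=
  [set x | exists (N : nat) (w : 'I_N -> R) (p : 'I_N -> 'cV[R]_m),
     [/\ forall i, 0 <= w i, \sum_i w i = 1, forall i, S (p i)
       & x = \sum_i w i *: p i]].

(* The coordinates are the edges of G, listed by enum_val. *)
Definition indicator (G : sgraph) (X : {set {set G}}) : 'cV[R]_#|edges G| :=
  \col_j (enum_val j \in X)%:R.

Definition solution_polytope (Pi : edge_subset_problem) (G : sgraph) :
    set 'cV[R]_#|edges G| :=
  convex_hull [set x | exists2 X, Pi G X & x = indicator X].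

(* Only the r inequalities are counted; linear equations are free. *)
Definition defined_with_inequalities (d : nat) (Q : set 'cV[R]_d) (r : nat) :
    Prop :=
  exists (q : nat) (A : 'M[R]_(r, d)) (b : 'cV[R]_r)
         (C : 'M[R]_(q, d)) (c : 'cV[R]_q),
    Q = [set y | (forall i, (A *m y) i ord0 <= b i ord0) /\ C *m y = c].

Definition bounded_region (d : nat) (Q : set 'cV[R]_d) : Prop :=
  exists M : R, forall y, Q y -> forall i, `|y i ord0| <= M.

(* Combined with [defined_with_inequalities], boundedness makes Q a polytope. *)
Definition is_extended_formulation (d m : nat) (Q : set 'cV[R]_d)
    (P : set 'cV[R]_m) : Prop :=
  bounded_region Q /\
  exists proj : 'M[R]_(m, d), [set proj *m y | y in Q] = P.

Definition extension_complexity_at_most (m : nat) (P : set 'cV[R]_m) (g : R) :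
    Prop :=
  exists (d r : nat) (Q : set 'cV[R]_d),
    [/\ is_extended_formulation Q P, defined_with_inequalities Q r & r%:R <= g].

Definition has_extension_complexity (Pi : edge_subset_problem)
    (f : nat -> nat -> R) : Prop :=
  forall (k n : nat) (G : sgraph), #|G| = n -> treewidth_at_most G k ->
    extension_complexity_at_most (@solution_polytope Pi G) (f k n).

(* The bound g(k,n) fails on the class of all n-vertex graphs of treewidth at
   most k, for some k and n: some graph of the class defeats it. *)
Definition has_no_extended_formulation (Pi : edge_subset_problem)
    (g : nat -> nat -> R) : Prop :=
  exists (k n : nat) (G : sgraph),
    [/\ #|G| = n, treewidth_at_most G k
      & ~ extension_complexity_at_most (@solution_polytope Pi G) (g k n)].

End Polytopes.

(* Repeating a literal yields the clauses with fewer than three literals. *)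
Definition literal (n : nat) : Type := ('I_n * bool)%type.
Definition clause3 (n : nat) : Type := (3.-tuple (literal n))%type.
Definition cnf3 (n : nat) : Type := seq (clause3 n).

Definition satisfiable (n : nat) (phi : cnf3 n) : bool :=
  [exists a : {ffun 'I_n -> bool},
    all (fun cl : clause3 n => has (fun x : literal n => a x.1 == x.2) cl) phi].

(* Variable indices are written in unary, terminated by [false] and followed by
   the sign of the literal.  As indices are < n, this lengthens a formula only
   polynomially compared with a binary encoding. *)
Definition encode_literal (n : nat) (x : literal n) : seq bool :=
  nseq (val x.1) true ++ [:: false; x.2].
Definition encode_clause (n : nat) (cl : clause3 n) : seq bool :=
  flatten [seq encode_literal x | x <- cl].
Definition encode (n : nat) (phi : cnf3 n) : seq bool :=
  flatten [seq encode_clause cl | cl <- phi].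

Inductive direction := MoveLeft | Stay | MoveRight.

(* Deterministic machine with one two-way infinite tape.  A cell holds [None]
   (blank), [Some (inl b)] (input bit) or [Some (inr w)] (work symbol). *)
Record turing_machine := TuringMachine {
  tm_state : finType;
  tm_work : finType;
  tm_start : tm_state;
  tm_verdict : tm_state -> option bool;
  tm_trans : tm_state -> option (bool + tm_work)%type ->
             tm_state * option (bool + tm_work)%type * direction }.

Section Run.
Variable M : turing_machine.

Definition cell : Type := option (bool + tm_work M)%type.

(* The cells left of the head are listed from the head outwards; cells beyond
   either list are blank. *)
Record config := Config {
  cf_state : tm_state M;
  cf_left : seq cell;
  cf_head : cell;
  cf_right : seq cell }.

Definition initial (x : seq bool) : config :=
  let t : seq cell := [seq Some (inl b) | b <- x] in
  Config (tm_start M) [::] (head None t) (behead t).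

Definition step (c : config) : config :=
  if tm_verdict (cf_state c) is Some _ then c else
  let: (s, a, dir) := tm_trans (cf_state c) (cf_head c) in
  match dir with
  | MoveLeft =>
      Config s (behead (cf_left c)) (head None (cf_left c)) (a :: cf_right c)
  | Stay => Config s (cf_left c) a (cf_right c)
  | MoveRight =>
      Config s (a :: cf_left c) (head None (cf_right c)) (behead (cf_right c))
  end.

Definition answers_within (x : seq bool) (t : nat) (ans : bool) : Prop :=
  tm_verdict (cf_state (iter t step (initial x))) = Some ans.

End Run.

Section ETH.
Local Open Scope ring_scope.

(* For some delta > 0, no algorithm decides 3-SAT on n variables in time
   2^(delta n) times a polynomial in the input length.  Since delta is
   existential, a polynomial slowdown between machine models is immaterial. *)
Definition ETH (R : realType) : Prop :=
  exists delta : R, 0 < delta /\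
    ~ exists (M : turing_machine) (K c : nat),
        forall (n : nat) (phi : cnf3 n),
          exists t : nat,
            t%:R <= K%:R * 2 `^ (delta * n%:R) * (size (encode phi)).+1%:R ^+ c
            /\ answers_within M (encode phi) t (satisfiable phi).

End ETH.

(* Main.v *)
Require Import Defs.
From HB Require Import structures.
From mathcomp Require Import all_boot all_order all_algebra.
From mathcomp Require Import reals.
From mathcomp Require Import zify ring lra.

(** Lower bound.  On a complete graph, the functional
    [2 sum x_i - (sum x_i)^2] with [i] in [a] is linear on cuts, has maximum 1,
    and has slack [(1 - |a n b|)^2] at the cut of [b].  The inequalities of an
    extended formulation cover the disjoint pairs [(a, b)] by rectangles
    containing no pair with [|a n b| = 1]; such a rectangle has at most [2^n]
    of the [3^n] disjoint pairs (Kaibel and Weltge), so [(3/2)^n] inequalities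
    are needed.

    Upper bound.  Dynamic programming over a rooted tree decomposition, with
    states (trace of the cut on the root bag, number of cut edges so far).
    Two programs are glued along a separator by variables indexed by the
    compatible pairs of states, whose marginals are the state probabilities of
    both parts; the glued program is integral because two distributions with
    given marginals can be coupled conditionally independently. *)

Set Implicit Arguments.
Unset Strict Implicit.
Unset Printing Implicit Defensive.

Import Order.TTheory GRing.Theory Num.Theory.

(** * Rectangles of disjoint pairs *)

Section DisjointPairs.
Variable T : finType.
Implicit Types (D a b : {set T}) (A B : pred {set T}).

Lemma big_powersetU1 (x : T) D (f : {set T} -> nat) : x \notin D ->
  \sum_(a in powerset (x |: D)) f a =
  \sum_(a in powerset D) (f a + f (x |: a)).
Proof.
move=> xD; rewrite big_split /= (bigID (fun a : {set T} => x \in a)) /= addnC.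
congr (_ + _).
  by apply: eq_bigl => a; rewrite !powersetE -[in RHS](setU1K xD) subsetD1.
rewrite (reindex_onto (fun a => x |: a) (fun a => a :\ x)) /=.
  apply: eq_bigl => a; rewrite !powersetE setU11 andbT.
  apply/andP/idP => [[sa /eqP ea]|sa].
    by rewrite -ea subDset.
  split; first exact: setUS.
  rewrite setU1K //; apply: contra xD; exact: (subsetP sa).
by move=> a /andP[_ xa]; rewrite setD1K.
Qed.

Definition disjoint_pairs D A B : nat :=
  \sum_(a in powerset D) \sum_(b in powerset D) (A a && B b && [disjoint a &
    b]).

(** The element [x] lies in neither set, in [b] only, or in [a] only; in the fourth case the pair is
    not disjoint. *)
Lemma disjoint_pairsU1 x D A B : x \notin D ->
  disjoint_pairs (x |: D) A B =
  disjoint_pairs D A B + disjoint_pairs D A (fun b => B (x |: b)) +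
  disjoint_pairs D (fun a => A (x |: a)) B.
Proof.
move=> xD; rewrite /disjoint_pairs big_powersetU1 // -!big_split /=.
apply: eq_bigr => a; rewrite powersetE => aD.
rewrite !big_powersetU1 // -!big_split /=; apply: eq_bigr => b.
rewrite powersetE => bD.
have xa : x \notin a by apply: contra xD; apply: (subsetP aD).
have xb : x \notin b by apply: contra xD; apply: (subsetP bD).
rewrite -!setI_eq0 -setUIr setU_eq0 -[[set x] == _]cards_eq0 cards1 andbF addn0.
have -> : a :&: (x |: b) = a :&: b.
  by apply/setP => y; rewrite !inE; case: eqP => // ->; rewrite (negPf xa).
have -> : (x |: a) :&: b = a :&: b.
  by apply/setP => y; rewrite !inE; case: eqP => // ->;
    rewrite /= (negPf xb) andbF.
by [].
Qed.

Lemma finset_ind (P : {set T} -> Prop) :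
  P set0 -> (forall x D, x \notin D -> P D -> P (x |: D)) -> forall D, P D.
Proof.
move=> P0 PU D; elim: {D}#|D| {-2}D (erefl #|D|) => [|n IHn] D.
  by move/eqP; rewrite cards_eq0 => /eqP->.
move=> cD; have /card_gt0P[x xD] : 0 < #|D| by rewrite cD.
rewrite -(setD1K xD); apply: PU; first by rewrite !inE eqxx.
by apply: IHn; move: cD; rewrite (cardsD1 x) xD => -[].
Qed.

Lemma disjoint_pairs_total D : disjoint_pairs D predT predT = 3 ^ #|D|.
Proof.
elim/finset_ind: D => [|x D xD IH].
  by rewrite /disjoint_pairs powerset0 !big_set1 cards0 -setI_eq0 setI0 eqxx.
rewrite disjoint_pairsU1 // [in RHS]cardsU1 xD /= expnS -IH.
rewrite -![disjoint_pairs D _ _]/(disjoint_pairs D predT predT).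
by rewrite 2!mulSn mul1n addnA.
Qed.

(* The pairs in [A x B] over [x |: D] inject into those of the two rectangles
   [A0 x (B0 u B1)] and [(A0 u A1) x B0] over [D], where the index records
   membership of [x]: no disjoint pair lies in [A1 x B1]. *)
Lemma disjoint_pairs_rect D A B :
  (forall a b, a \subset D -> b \subset D -> A a -> B b -> #|a :&: b| != 1) ->
  disjoint_pairs D A B <= 2 ^ #|D|.
Proof.
elim/finset_ind: D A B => [|x D xD IH] A B AB.
  rewrite /disjoint_pairs powerset0 !big_set1 cards0; exact: leq_b1.
rewrite disjoint_pairsU1 // cardsU1 xD /= add1n expnS mul2n -addnn.
have sDU : D \subset x |: D by exact: subsetUr.
have notx a : a \subset D -> x \notin a.
  by move=> aD; apply: contra xD; apply: (subsetP aD).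
have IA : forall a b, a \subset D -> b \subset D ->
    A a -> B b || B (x |: b) -> #|a :&: b| != 1.
  move=> a b aD bD Aa /orP[Bb|Bb].
    by apply: AB => //; apply: subset_trans sDU.
  have -> : a :&: b = a :&: (x |: b).
    apply/setP => y; rewrite !inE; case: eqP => // ->.
    by rewrite (negPf (notx _ aD)).
  by apply: AB => //; [apply: subset_trans sDU | apply: setUS].
have IB : forall a b, a \subset D -> b \subset D ->
    A a || A (x |: a) -> B b -> #|a :&: b| != 1.
  move=> a b aD bD /orP[Aa|Aa] Bb.
    by apply: AB => //; apply: subset_trans sDU.
  have -> : a :&: b = (x |: a) :&: b.
    apply/setP => y; rewrite !inE; case: eqP => // ->.
    by rewrite /= (negPf (notx _ bD)) andbF.
  by apply: AB => //; [apply: setUS | apply: subset_trans sDU].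
apply: leq_trans (leq_add (IH _ _ IA) (IH _ _ IB)).
rewrite /disjoint_pairs -!big_split /=; apply: leq_sum => a.
rewrite powersetE => aD; rewrite -!big_split /=; apply: leq_sum => b.
rewrite powersetE => bD.
(* For disjoint [a] and [b], the sets [x |: a] and [x |: b] meet in [x] alone, which [AB]
   forbids. *)
have : ~~ [&& A (x |: a), B (x |: b) & [disjoint a & b]].
  apply/and3P => -[Aa Bb dab].
  have := AB _ _ (setUS [set x] aD) (setUS [set x] bD) Aa Bb.
  by rewrite -setUIr (eqP (_ : a :&: b == set0)) ?setU0 ?cards1 // setI_eq0.
by case: (A a); case: (A _); case: (B b); case: (B _); case: [disjoint a & b].
Qed.

(** Double counting: the [3 ^ #|T|] disjoint pairs are covered by rectangles holding at most
    [2 ^ #|T|] of them each. *)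
Lemma rect_cover_bound (I : finType) (A B : I -> pred {set T}) :
  (forall i a b, A i a -> B i b -> #|a :&: b| != 1) ->
  (forall a b, [disjoint a & b] -> exists2 i, A i a & B i b) ->
  3 ^ #|T| <= #|I| * 2 ^ #|T|.
Proof.
move=> valid cover.
have -> : 3 ^ #|T| = disjoint_pairs [set: T] predT predT.
  by rewrite disjoint_pairs_total cardsT.
apply: (@leq_trans (\sum_i disjoint_pairs [set: T] (A i) (B i))); last first.
  rewrite -sum_nat_const; apply: leq_sum => i _; rewrite -cardsT.
  by apply: disjoint_pairs_rect => a b _ _; apply: valid.
rewrite /disjoint_pairs [leqRHS]exchange_big /=; apply: leq_sum => a _.
rewrite [leqRHS]exchange_big /=; apply: leq_sum => b _.
case dab: [disjoint a & b] => //=.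
have [i Aa Bb] := cover a b dab.
by rewrite (bigD1 i) //= Aa Bb.
Qed.

End DisjointPairs.

(** * Cuts *)

(** Phrased without endpoints, so that it makes sense for any set [e] and depends on [A] only
    through [e :&: A]. *)
Definition splits (T : finType) (A e : {set T}) : bool :=
  (e :&: A != set0) && ~~ (e \subset A).

Definition cut (G : sgraph) (A : {set G}) : {set {set G}} :=
  [set e in edges G | splits A e].

Lemma in_cut (G : sgraph) (A e : {set G}) :
  (e \in cut A) = (e \in edges G) && splits A e.
Proof. by rewrite [LHS]inE. Qed.

Lemma splits_pair (T : finType) (A : {set T}) x y :
  splits A [set x; y] = (x \in A) (+) (y \in A).
Proof.
rewrite /splits subUset !sub1set; apply/andP/idP => [[/set0Pn[z]]|].
  by rewrite !inE => /andP[/orP[]/eqP-> ->]; [case: (y \in A)|case: (x \in A)].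
case xA: (x \in A); case yA: (y \in A) => //= _; split=> //.
  by apply/set0Pn; exists x; rewrite !inE eqxx xA.
by apply/set0Pn; exists y; rewrite !inE eqxx yA orbT.
Qed.

Lemma is_cutsetE (G : sgraph) (X : {set {set G}}) :
  is_cutset X <-> exists A, X = cut A.
Proof.
have cutE (A : {set G}) : cut_of A (~: A) = cut A.
  apply/setP => e; rewrite [LHS]inE in_cut.
  case eE: (e \in edges G) => //=; apply/exists_inP/idP.
    case=> x xA /exists_inP[y]; rewrite inE => yA /eqP->.
    by rewrite splits_pair xA (negPf yA).
  move: eE; rewrite inE => /existsP[x /existsP[y /andP[_ /eqP->]]].
  rewrite splits_pair; case xA: (x \in A); case yA: (y \in A) => //= _.
    by exists x => //; apply/exists_inP; exists y => //; rewrite inE yA.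
  exists y => //; apply/exists_inP; exists x; first by rewrite inE xA.
  by rewrite setUC.
split=> [[A [B [AB dAB ->]]]|[A ->]]; exists A.
  rewrite -cutE; congr cut_of; apply/setP => x; rewrite inE.
  have := in_setT x; rewrite -AB inE; case xA: (x \in A) => //=.
  by rewrite (disjointFr dAB xA).
by exists (~: A); rewrite cutE setUCr -setI_eq0 setICr eqxx.
Qed.

Definition complete_graph (V : finType) : sgraph :=
  @SGraph V (fun x y => x != y) (fun x y => congr1 negb (eq_sym x y))
    (fun x => negbF (eqxx x)).

Lemma edges_complete (V : finType) (x y : V) :
  ([set x; y] \in edges (complete_graph V)) = (x != y).
Proof.
rewrite inE; apply/existsP/idP => [[u /existsP[v /andP[/= uv /eqP exy]]]|xy].
  apply: contraNneq uv => xy; move: exy; rewrite xy setUid => e.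
  have : u \in [set y] by rewrite e !inE eqxx.
  have : v \in [set y] by rewrite e !inE eqxx orbT.
  by rewrite !inE => /eqP-> /eqP->.
by exists x; apply/existsP; exists y; rewrite /= xy eqxx.
Qed.

Lemma treewidth_trivial (G : sgraph) (k : nat) :
  #|G| <= k.+1 -> treewidth_at_most G k.
Proof.
move=> Gk; exists (complete_graph unit), (fun=> [set: G]); split; last first.
  by move=> _; rewrite cardsT.
split.
- split; first by rewrite card_unit.
    by move=> [] []; apply: connect0.
  by case=> [|[] [|[] p]] //= _; rewrite /ucycleb /= !inE eqxx /= andbF.
- by move=> v; exists tt; rewrite inE.
- by move=> e _; exists tt; apply: subsetT.
- by move=> v [] [] _ _; apply: connect0.
Qed.

(** * Rooted tree decompositions *)

Section RootedDecomposition.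
Variables (V : finType) (k : nat).
Implicit Types (B U : {set V}) (F : {set {set V}}).

(* [rdec B U F N]: the vertices [U] and the edges [F] are decomposed by a tree
   with [N] nodes and root bag [B]; each edge is charged to a single bag. *)
Inductive rdec : {set V} -> {set V} -> {set {set V}} -> nat -> Prop :=
| rdec_bag B F :
    #|B| <= k.+1 -> (forall e, e \in F -> e \subset B) -> rdec B B F 1
| rdec_glue B1 U1 F1 N1 B2 U2 F2 N2 :
    rdec B1 U1 F1 N1 -> rdec B2 U2 F2 N2 ->
    U1 :&: U2 \subset B1 :&: B2 -> [disjoint F1 & F2] ->
    rdec B1 (U1 :|: U2) (F1 :|: F2) (N1 + N2).

Lemma rdec_root B U F N : rdec B U F N -> B \subset U.
Proof.
elim=> // B1 U1 F1 N1 B2 U2 F2 N2 _ s1 _ _ _ _.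
exact: subset_trans s1 (subsetUl _ _).
Qed.

Lemma rdec_size B U F N : rdec B U F N -> 0 < N.
Proof. by elim=> // *; rewrite addn_gt0; apply/orP; left. Qed.

(** A glued decomposition keeps the root bag of its first part, so the new edges can be passed down
    the leftmost branch to the leaf with bag [B]. *)
Lemma rdec_addedges B U F N F' : rdec B U F N ->
  (forall e, e \in F' -> e \subset B) -> [disjoint F & F'] ->
  rdec B U (F :|: F') N.
Proof.
move=> dec; elim: dec F' => {B U F N} [B F kB FB|B1 U1 F1 N1 B2 U2 F2 N2].
  move=> F' FB' _; apply: rdec_bag => // e; rewrite inE.
  by case/orP => [/FB|/FB'].
move=> _ IH1 d2 _ sU dF F' FB' dF'.
rewrite -setUA (setUC F2) setUA; apply: (rdec_glue _ d2) => //.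
  by apply: IH1 => //; apply: disjointWl dF'; apply: subsetUl.
rewrite -setI_eq0 setIUl setU_eq0 setI_eq0 dF setI_eq0 disjoint_sym.
by apply: disjointWl dF'; apply: subsetUr.
Qed.

(** The second root node is absorbed: its edges fit into [B1] and its other subtrees are glued to
    [B1] instead. The node saved here keeps the size of a decomposition bounded by the number of
    vertices. *)
Lemma rdec_merge B1 U1 F1 N1 B2 U2 F2 N2 :
  rdec B1 U1 F1 N1 -> rdec B2 U2 F2 N2 -> B2 \subset B1 ->
  U1 :&: U2 \subset B2 -> [disjoint F1 & F2] ->
  rdec B1 (U1 :|: U2) (F1 :|: F2) (N1 + N2).-1.
Proof.
move=> d1 d2; elim: d2 => {B2 U2 F2 N2} [B2 F2 kB2 FB2|B2 U2 F2 N2 B3 U3 F3 N3].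
  move=> sB _ dF; rewrite addn1 /=.
  have -> : U1 :|: B2 = U1.
    by apply/setUidPl; apply: subset_trans sB (rdec_root d1).
  by apply: rdec_addedges => // e /FB2 /subset_trans; apply.
move=> d2 IH d3 _ sU23 dF23 sB sU dF.
have sB2 := rdec_root d2.
have /IH : U1 :&: U2 \subset B2.
  by apply: subset_trans sU; apply: setIS; apply: subsetUl.
rewrite !setUA.
have -> : (N1 + (N2 + N3)).-1 = (N1 + N2).-1 + N3.
  by have := rdec_size d1; lia.
move=> {}IH; apply: (rdec_glue _ d3).
- apply: IH => //; apply: disjointWr dF; exact: subsetUl.
- apply/subsetP => x; rewrite !inE => /andP[xU x3].
  have x2 : x \in U2.
    case/orP: xU => [x1|//]; apply: (subsetP sB2); apply: (subsetP sU).
    by rewrite !inE x1 x3 orbT.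
  have : x \in B2 :&: B3 by apply: (subsetP sU23); rewrite inE x2 x3.
  by rewrite !inE => /andP[/(subsetP sB)-> ->].
- rewrite -setI_eq0 setIUl setU_eq0 !setI_eq0 dF23 andbT.
  by apply: disjointWr dF; apply: subsetUr.
Qed.

End RootedDecomposition.

(** * Edge deletion in forests and in tree decompositions *)

Section Forest.
Variable I : finType.
Implicit Types (e : rel I) (a b i j : I).

Definition del_edge e i j : rel I :=
  [rel a b | e a b && ~~ ((a == i) && (b == j) || (a == j) && (b == i))].

(** Every edge is a bridge: the form of acyclicity that suits a recursion by edge deletion. *)
Definition acyclic e := forall i j, e i j -> ~~ connect (del_edge e i j) i j.

Lemma del_edge_sym e i j : symmetric e -> symmetric (del_edge e i j).
Proof.
move=> se a b; rewrite /del_edge /= se; congr (_ && ~~ _).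
by rewrite orbC [(b == j) && _]andbC [(b == i) && _]andbC.
Qed.

Lemma connect_mono e e' : (forall a b, e a b -> e' a b) ->
  forall a b, connect e a b -> connect e' a b.
Proof. by move=> ee'; apply: connect_sub => a b /ee'; apply: connect1. Qed.

(** By induction along the path, two crossings of the edge in opposite directions cancel, and of two
    in the same direction one suffices. *)
Lemma connect_del_edge e i j a b : symmetric e -> connect e a b ->
  connect (del_edge e i j) a b \/
  e i j /\ (connect (del_edge e i j) a i /\ connect (del_edge e i j) j b \/
            connect (del_edge e i j) a j /\ connect (del_edge e i j) i b).
Proof.
move=> se /connectP[p]; elim: p a => [|c p IH] a /=.
  by move=> _ ->; left; apply: connect0.
move=> /andP[eac pc] lb; have {IH} IH := IH c pc lb.
have [eac'|] := boolP (del_edge e i j a c).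
  have tr := connect_trans (connect1 eac').
  case: IH => [/tr|[eij [[/tr ci jb]|[/tr cj ib]]]]; first by left.
    by right; split=> //; left.
  by right; split=> //; right.
rewrite /del_edge /= eac /= negbK => /orP[]/andP[/eqP ai /eqP cj]; subst a c.
  case: IH => [jb|[_ [[_ jb]|[_ ib]]]].
  - by right; split=> //; left.
  - by right; split=> //; left.
  - by left.
rewrite se in eac; case: IH => [ib|[_ [[_ jb]|[_ ib]]]].
- by right; split=> //; right.
- by left.
- by right; split=> //; right.
Qed.

Lemma acyclic_del_edge e i j : acyclic e -> acyclic (del_edge e i j).
Proof.
move=> ae a b /= /andP[/ae + _]; apply: contraNN; apply: connect_mono => x y /=.
by move=> /andP[/andP[exy _] nxy]; rewrite /del_edge /= exy.
Qed.

Variables (V : finType) (k : nat) (bag : I -> {set V}).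

Definition bag_rel e v : rel I := [rel a b | [&& e a b, v \in bag a & v \in bag
  b]].

(** Only bags in one component of [e] have to be linked, so that the property can survive the
    deletion of an edge. *)
Definition coherent e := forall v a b, connect e a b ->
  v \in bag a -> v \in bag b -> connect (bag_rel e v) a b.

Lemma bag_rel_sym e v : symmetric e -> symmetric (bag_rel e v).
Proof. by move=> se a b; rewrite /bag_rel /= se [(v \in bag a) && _]andbC. Qed.

Lemma connect_bag_rel e v a b : connect (bag_rel e v) a b -> connect e a b.
Proof. by apply: connect_mono => x y /andP[]. Qed.

Lemma bag_rel_del_edge e v i j a b :
  connect (del_edge (bag_rel e v) i j) a b ->
  connect (bag_rel (del_edge e i j) v) a b.
Proof.
by apply: connect_mono => x y /andP[/and3P[exy vx vy] nxy];
  rewrite /bag_rel /del_edge /= exy vx vy !andbT.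
Qed.

(** If the link between the bags of [v] needed the edge [i j], then, [a] and [b] being connected
    without it, [i j] would not be a bridge. *)
Lemma coherent_del_edge e i j : symmetric e -> acyclic e -> e i j ->
  coherent e -> coherent (del_edge e i j).
Proof.
move=> se ae eij ce v a b cab va vb.
have cs := sym_connect_sym (del_edge_sym i j se).
have cab' : connect e a b by apply: connect_mono cab => x y /andP[].
have := connect_del_edge i j (bag_rel_sym v se) (ce v a b cab' va vb).
case=> [/bag_rel_del_edge//|[_ H]]; have /negP[] := ae i j eij.
case: H => -[/bag_rel_del_edge/connect_bag_rel c1
  /bag_rel_del_edge/connect_bag_rel c2].
  by rewrite cs in c1; rewrite cs in c2; apply: connect_trans c1 (connect_trans
    cab c2).
apply: connect_trans c2 _; rewrite cs; rewrite cs in c1.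
exact: connect_trans c1 cab.
Qed.

(** The link between two bags of [v] on opposite sides of a bridge must cross the bridge, and all
    bags on it contain [v]. *)
Lemma separator e i j v a b : symmetric e -> acyclic e -> coherent e -> e i j ->
  connect (del_edge e i j) i a -> connect (del_edge e i j) j b ->
  v \in bag a -> v \in bag b -> (v \in bag i) && (v \in bag j).
Proof.
move=> se ae ce eij ia jb va vb.
have cs := sym_connect_sym (del_edge_sym i j se).
have weak x y : connect (del_edge e i j) x y -> connect e x y.
  by apply: connect_mono => ? ? /andP[].
have cab : connect e a b.
  apply: connect_trans (weak _ _ _) (connect_trans (connect1 eij) (weak _ _
    jb)).
  by rewrite cs.
case: (connect_del_edge i j (bag_rel_sym v se) (ce v a b cab va vb)).
  move=> /bag_rel_del_edge/connect_bag_rel c1; have /negP[] := ae i j eij.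
  apply: connect_trans ia (connect_trans c1 _); by rewrite cs.
by case=> /and3P[_ -> ->].
Qed.

Definition cover_of e i := \bigcup_(a | connect e i a) bag a.

Lemma mem_cover e i v : reflect (exists2 a, connect e i a & v \in bag a) (v \in
  cover_of e i).
Proof. exact: bigcupP. Qed.

(** Induction on the number of edges of the forest: delete an edge [i j], decompose the sides of [i]
    and [j], and glue. If [bag j] lies in [bag i], the node [j] is merged away; otherwise a vertex
    of [bag j] outside [bag i] pays for it. This gives the bound on [N]. *)
Lemma forest_rdec e i (F : {set {set V}}) :
  symmetric e -> acyclic e -> coherent e -> (forall a, #|bag a| <= k.+1) ->
  (forall f, f \in F -> exists2 a, connect e i a & f \subset bag a) ->
  exists2 N, rdec k (bag i) (cover_of e i) F N & N <= #|cover_of e i :\: bag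
    i|.+1.
Proof.
move=> + + + kbag.
have [n] := ubnP #|[set p : I * I | e p.1 p.2]|.
elim: n => // n IHn in e i F * => en se ae ce Fb.
have [/existsP[j eij]|/existsPn iso] := boolP [exists j, e i j]; last first.
  have ci a : connect e i a -> a = i.
    by case/connectP => [[|b p]] //= /andP[eib]; have := iso b; rewrite eib.
  have -> : cover_of e i = bag i.
    rewrite /cover_of (big_pred1 i) // => a; apply/idP/eqP => [/ci//|->].
    exact: connect0.
  exists 1 => //; apply: rdec_bag => // f /Fb[a /ci->] //.
pose e' := del_edge e i j.
have se' : symmetric e' by apply: del_edge_sym.
have cs := sym_connect_sym se'.
have e'n : #|[set p : I * I | e' p.1 p.2]| < n.
  rewrite -ltnS; apply: leq_trans en; rewrite ltnS; apply: proper_card.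
  apply/properP; split; first by apply/subsetP => p; rewrite !inE => /andP[].
  by exists (i, j); rewrite inE // /e' /del_edge /= !eqxx andbF.
have ae' : acyclic e' by apply: acyclic_del_edge.
have ce' : coherent e' by apply: coherent_del_edge.
have weak x y : connect e' x y -> connect e x y.
  by apply: connect_mono => ? ? /andP[].
have split_conn a : connect e i a = connect e' i a || connect e' j a.
  apply/idP/orP => [|[/weak//|/weak]]; last exact: connect_trans (connect1 eij).
  by case/(connect_del_edge i j se) => [|[_ [[_]|[_]]]]; [left|right|left].
pose F2 := [set f in F | [exists a, connect e' j a && (f \subset bag a)]].
have [|N2 d2 N2b] := IHn e' j F2 e'n se' ae' ce'.
  by move=> f; rewrite inE => /andP[_ /existsP[a /andP[? ?]]]; exists a.
have [|N1 d1 N1b] := IHn e' i (F :\: F2) e'n se' ae' ce'.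
  move=> f; rewrite inE => /andP[fF2 fF]; have [a] := Fb f fF.
  rewrite split_conn => /orP[ia fa|ja fa]; first by exists a.
  by move: fF2; rewrite inE fF /= => /existsPn/(_ a); rewrite ja fa.
have -> : cover_of e i = cover_of e' i :|: cover_of e' j.
  apply/setP => v; rewrite inE; apply/mem_cover/orP => [[a]|[]].
  - by rewrite split_conn => /orP[] ? ?; [left|right]; apply/mem_cover;
      exists a.
  - by move=> /mem_cover[a ia va]; exists a => //; rewrite split_conn ia.
  - by move=> /mem_cover[a ia va]; exists a => //; rewrite split_conn ia orbT.
move: (cover_of e' i) (cover_of e' j) (@mem_cover e' i) (@mem_cover e' j) d1 d2
  N1b N2b.
move=> U1 U2 U1P U2P d1 d2 N1b N2b.
have sU : U1 :&: U2 \subset bag i :&: bag j.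
  apply/subsetP => v; rewrite !inE => /andP[/U1P[a ia va] /U2P[b jb vb]].
  exact: separator va vb.
have sB1 := rdec_root d1; have sB2 := rdec_root d2.
have dF : [disjoint F :\: F2 & F2] by rewrite -setI_eq0 setIDAC setDIl setDv
  setI0.
have -> : F = (F :\: F2) :|: F2.
  rewrite -{1}(setID F F2) setUC; congr (_ :|: _); apply/setIidPr.
  by apply/subsetP => f; rewrite inE => /andP[].
(* Vertices common to both sides lie in both bags, so outside the bags the counts add up. *)
have card1 : #|(U1 :|: U2) :\: bag i| = #|U1 :\: bag i| + #|U2 :\: bag i|.
  rewrite setDUl -[RHS]cardsUI [_ :&: _](_ : _ = set0) ?cards0 ?addn0 //.
  apply/setP => v; rewrite !inE; apply/negP => /andP[/andP[vi v1] /andP[_ v2]].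
  have : v \in bag i :&: bag j by apply: (subsetP sU); rewrite inE v1 v2.
  by rewrite inE (negPf vi).
have card2 : #|U2 :\: bag i| = #|U2 :\: bag j| + #|bag j :\: bag i|.
  rewrite -[RHS]cardsUI [X in _ + #|pred_of_set X|](_ : _ = set0) ?cards0 ?addn0
    //; last first.
    by apply/setP => v; rewrite !inE; case: (v \in bag j); rewrite ?andbF.
  congr #|pred_of_set _|; apply/setP => v; rewrite !inE.
  have := subsetP sU v; rewrite !inE => /implyP.
  have /implyP := subsetP sB2 v; have /implyP := subsetP sB1 v.
  by case: (v \in bag i); case: (v \in bag j); case: (v \in U1);
    case: (v \in U2).
have [sji|nsji] := boolP (bag j \subset bag i).
  exists (N1 + N2).-1.
    by apply: (rdec_merge d1 d2) => //; apply: subset_trans sU (subsetIr _ _).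
  rewrite card1 card2; have := rdec_size d1; lia.
exists (N1 + N2); first exact: (rdec_glue d1 d2).
have : 0 < #|bag j :\: bag i|.
  by rewrite card_gt0 setD_eq0.
rewrite card1 card2; lia.
Qed.

End Forest.

(** A simple path from [i] to [j] avoiding the edge [i j] has an inner vertex, so the edge closes it
    to a cycle on at least three vertices. *)
Lemma tree_acyclic (I : sgraph) : is_tree I -> acyclic (@adj I).
Proof.
case=> _ _ nocycle i j eij; apply/negP => /connectP[p pp lp].
move: lp; case/shortenP: pp => p' pp' up' _ lp.
have sub : subrel (del_edge (@adj I) i j) (@adj I) by move=> x y /andP[].
have p2 : 2 < size (i :: p').
  case: p' lp pp' {up'} => [|b [|c p']] //= lp.
    by move: eij; rewrite lp adj_irr.
  by rewrite -lp /del_edge /= !eqxx andbF.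
have /negP[] := nocycle _ p2; rewrite /ucycleb up' andbT /=.
by rewrite rcons_path (sub_path sub pp') -lp adj_sym.
Qed.

(** A tree decomposition may have arbitrarily many nodes; the bound on [N] makes the program built
    from it polynomial in the order of [G]. *)
Lemma treewidth_rdec (G : sgraph) k : treewidth_at_most G k ->
  exists B N, rdec k B [set: G] (edges G) N /\ N <= #|G|.+1.
Proof.
case=> I [bag [[treeI cv ce coh] kbag]].
have [/card_gt0P[i _] conn _] := treeI.
have UT : cover_of bag (@adj I) i = [set: G].
  apply/setP => v; rewrite inE; apply/mem_cover; have [a va] := cv v.
  by exists a.
have [|||f /ce[a fa]|N] := @forest_rdec I G k bag (@adj I) i (edges G) _ _ _
  kbag.
- exact: adj_sym.
- exact: tree_acyclic.
- by move=> v a b _ va vb; apply: coh.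
- by exists a.
rewrite UT => d Nb; exists (bag i), N; split=> //; apply: leq_trans Nb _.
by rewrite ltnS max_card.
Qed.

Local Open Scope ring_scope.

(** * Lower bound for complete graphs *)

(* Inequality [i] gives the rectangle of those [(a, t)] such that [i] is tight
   at every [y s] with [#|a :&: s| = 1] but not at [y t].  If a disjoint pair
   [(a, t)] with [a != set0] were in none of these, one could move from the
   barycentre of the [y s] slightly away from [y t] and stay feasible, which
   violates [g a]. *)
Lemma correlation_slack_bound (R : realFieldType) (n d r q : nat)
    (A : 'M[R]_(r, d)) (b : 'cV[R]_r) (C : 'M[R]_(q, d)) (c : 'cV[R]_q)
    (y : {set 'I_n} -> 'cV[R]_d) (g : {set 'I_n} -> 'rV[R]_d) :
  (forall s i, (A *m y s) i ord0 <= b i ord0) ->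
  (forall s, C *m y s = c) ->
  (forall a z, (forall i, (A *m z) i ord0 <= b i ord0) -> C *m z = c ->
     (g a *m z) ord0 ord0 <= 1) ->
  (forall a s, (g a *m y s) ord0 ord0 = 1 - (1 - #|a :&: s|%:R) ^+ 2) ->
  (3 ^ n <= r.+1 * 2 ^ n)%N.
Proof.
move=> yA yC valid slack.
pose sl i (z : 'cV[R]_d) := b i ord0 - (A *m z) i ord0.
(* The extra rectangle [None] takes the pairs with [a] empty, for which no [s] has [#|a :&: s| = 1];
   it accounts for [r.+1]. *)
pose RA (o : option 'I_r) (a : {set 'I_n}) := if o is Some i then
  [forall s, (#|a :&: s| == 1%N) ==> (sl i (y s) == 0)] else a == set0.
pose RB (o : option 'I_r) (t : {set 'I_n}) := if o is Some i then
  sl i (y t) != 0 else true.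
have := @rect_cover_bound 'I_n (option 'I_r) RA RB.
rewrite card_option !card_ord; apply.
  move=> [i|] a t /=; last by move=> /eqP-> _; rewrite set0I cards0.
  by move=> /forallP/(_ t) /implyP ia it; apply: contra it.
move=> a t dat; have [a0|a0] := eqVneq a set0; first by exists None => //;
  apply/eqP.
have [/existsP[o /andP[]]|/existsPn nocov] := boolP [exists o, RA o a && RB o
  t].
  by exists o.
exfalso.
pose S1 := [set s : {set 'I_n} | #|a :&: s| == 1%N].
have [x xa] := set0Pn _ a0.
have S1x : [set x] \in S1.
  by rewrite inE (setIidPr _) ?cards1 // sub1set.
have N0 : 0 < #|S1|%:R :> R by rewrite ltr0n; apply/card_gt0P; exists [set x].
pose yb := #|S1|%:R^-1 *: \sum_(s in S1) y s.
have slyb i : sl i yb = #|S1|%:R^-1 * \sum_(s in S1) sl i (y s).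
  rewrite /sl /yb -scalemxAr mulmx_sumr mxE summxE sumrB sumr_const.
  by rewrite mulrBr -(mulr_natl (b i ord0)) mulKf // gt_eqF.
have sl_ge0 i s : 0 <= sl i (y s) by rewrite subr_ge0.
have slyb_ge0 i : 0 <= sl i yb.
  by rewrite slyb mulr_ge0 ?invr_ge0 ?ler0n // sumr_ge0.
have tight i : sl i yb = 0 -> sl i (y t) = 0.
  move=> iyb; apply/eqP; apply: contraT => it.
  have /negP[] := nocov (Some i); rewrite /= it andbT.
  apply/forallP => s; apply/implyP => sS.
  move: iyb; rewrite slyb => /eqP; rewrite mulf_eq0 invr_eq0 gt_eqF //=.
  by rewrite psumr_eq0 // => /allP/(_ s) /=; rewrite mem_index_enum inE sS;
    exact.
(* A step of length [e] away from [y t] keeps inequality [i] if [e * h i <= 1]. Where [sl i yb]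
   vanishes, [h i] is 0 by convention, and [tight] shows that the step leaves this slack at 0. *)
pose h i := sl i (y t) / sl i yb.
have h_ge0 i : 0 <= h i by rewrite divr_ge0.
pose e := (1 + \sum_i h i)^-1.
have e_gt0 : 0 < e by rewrite invr_gt0 ltr_wpDr // sumr_ge0.
have he i : e * h i <= 1.
  rewrite mulrC ler_pdivrMr ?mul1r; last by rewrite ltr_wpDr // sumr_ge0.
  rewrite (bigD1 i) //= addrCA lerDl addr_ge0 // sumr_ge0 //.
have := valid a (yb + e *: (yb - y t)).
have Cyb : C *m yb = c.
  rewrite /yb -scalemxAr mulmx_sumr (eq_bigr (fun=> c)) //.
  by rewrite sumr_const -scaler_nat scalerA mulVf ?scale1r // gt_eqF.
have gyb : (g a *m yb) ord0 ord0 = 1.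
  rewrite /yb -scalemxAr mulmx_sumr mxE summxE (eq_bigr (fun=> 1)).
    by rewrite sumr_const mulVf // gt_eqF.
  by move=> s; rewrite inE slack => /eqP->; rewrite subrr expr0n subr0.
clear slyb; clearbody yb.
have gyt : (g a *m y t) ord0 ord0 = 0.
  rewrite slack (eqP (_ : a :&: t == set0)) ?setI_eq0 // cards0 subr0 expr1n.
  by rewrite subrr.
have -> : (g a *m (yb + e *: (yb - y t))) ord0 ord0 = 1 + e.
  rewrite mulmxDr -scalemxAr mulmxBr.
  move: gyb gyt; rewrite !mxE => -> ->.
  by rewrite subr0 mulr1.
move=> H; have : 1 + e <= 1; last by rewrite gerDl leNgt e_gt0.
apply: H.
  move=> i; rewrite -subr_ge0 -/(sl i _).
  have -> : sl i (yb + e *: (yb - y t)) = sl i yb + e * (sl i yb - sl i (y t)).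
    rewrite /sl mulmxDr -scalemxAr mulmxBr !mxE; ring.
  have [/[dup] /tight -> ->|s0] := eqVneq (sl i yb) 0;
    first by rewrite subrr mulr0 addr0.
  have <- : h i * sl i yb = sl i (y t) by rewrite /h divfK.
  rewrite mulrBr mulrA addrA subr_ge0.
  apply: (@le_trans _ _ (1 * sl i yb)); first exact: ler_wpM2r.
  by rewrite mul1r lerDl mulr_ge0 // ltW.
by rewrite mulmxDr -scalemxAr mulmxBr Cyb yC subrr scaler0 addr0.
Qed.

Section CutPolytope.
Variables (R : realType) (G : sgraph).

Definition edge_row (w : {set G} -> R) : 'rV[R]_#|edges G| :=
  \row_j w (enum_val j).

Lemma edge_row_indicator w (A : {set G}) :
  (edge_row w *m indicator R (cut A)) ord0 ord0 = \sum_(e in cut A) w e.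
Proof.
rewrite mxE (eq_bigr (fun j : 'I_#|edges G| =>
  w (enum_val j) * (enum_val j \in cut A)%:R)); last first.
  by move=> j _; rewrite !mxE.
rewrite -(big_enum_val (fun e => w e * (e \in cut A)%:R)) /=.
rewrite big_mkcond [RHS]big_mkcond /=; apply: eq_bigr => e _.
rewrite in_cut; case: (e \in edges G) => //=.
by case: (splits A e); rewrite ?mulr1 ?mulr0.
Qed.

Lemma edge_row_solution w (l : nat) (b : R) (x : 'cV[R]_#|edges G|) :
  (forall A : {set G}, \sum_(e in cut A) w e <= b) ->
  solution_polytope (Cut l) x -> (edge_row w *m x) ord0 ord0 <= b.
Proof.
move=> wb [N [c [p [c0 c1 pS ->]]]].
rewrite mulmx_sumr summxE -[b]mul1r -c1 mulr_suml; apply: ler_sum => i _.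
rewrite -scalemxAr mxE; apply: ler_wpM2l => //.
have [X [/is_cutsetE[A ->] _] ->] := pS i.
by rewrite edge_row_indicator.
Qed.

End CutPolytope.

Section LowerBound.
Variables (R : realType) (n l : nat).

(** [None] is the reference vertex, and the side of the vertex [v i] encodes membership of [i]. The
    [l] others, always placed opposite [None], guarantee [l] cut edges. *)
Let V : finType := option ('I_n + 'I_l)%type.
Let K := complete_graph V.
Let v (i : 'I_n) : V := Some (inl i).

(* The restriction to cuts of 2 * sum_i x_i - (sum_i x_i)^2, with sums over
   i in a, where x_i = 1 if the cut separates i from None: for i != j the
   product x_i x_j is half of x_i + x_j minus the indicator of the edge ij. *)
Let w (a : {set 'I_n}) (e : {set V}) : R :=
  \sum_(i in a) (e == [set None; v i])%:R -
  \sum_(i in a) \sum_(j in a | j != i)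
    ((e == [set None; v i])%:R + (e == [set None; v j])%:R
     - (e == [set v i; v j])%:R) / 2.

Let t (a : {set 'I_n}) (A : {set K}) : nat :=
  #|a :&: [set i | splits A [set None; v i]]|.

Lemma sum_w_cut a (A : {set K}) :
  \sum_(e in cut A) w a e = 1 - (1 - (t a A)%:R) ^+ 2.
Proof.
have sumE (x y : V) : x != y ->
    \sum_(e in cut A) (e == [set x; y])%:R = ((x \in A) (+) (y \in A))%:R :> R.
  move=> xy; rewrite -splits_pair.
  have -> : splits A [set x; y] = ([set x; y] \in cut A).
    by rewrite (@in_cut K) edges_complete xy.
  rewrite -natr_sum; congr _%:R; case: (boolP (_ \in cut A)) => xyA.
    by rewrite (bigD1 _ xyA) /= eqxx big1 // => e /andP[_ /negPf->].
  by rewrite big1 // => e eA; case: eqP => // exy; rewrite -exy eA in xyA.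
pose b i : R := (splits A [set None; v i])%:R.
have tE : (t a A)%:R = \sum_(i in a) b i.
  rewrite /t -sum1_card natr_sum big_mkcond [RHS]big_mkcond /=.
  apply: eq_bigr => i _; rewrite !inE /b; case: (i \in a) => //=.
  by case: splits.
have sumw : \sum_(e in cut A) w a e =
    \sum_(i in a) b i - \sum_(i in a) \sum_(j in a | j != i) b i * b j.
  rewrite sumrB exchange_big /=; congr (_ - _).
    by apply: eq_bigr => i _; rewrite sumE // /b splits_pair.
  rewrite exchange_big /=; apply: eq_bigr => i _.
  rewrite exchange_big /=; apply: eq_bigr => j /andP[_ ji].
  rewrite -mulr_suml sumrB big_split /= !sumE //; last first.
    by apply: contra_neq ji => -[].
  rewrite /b !splits_pair.
  by case: (None \in A); case: (v i \in A); case: (v j \in A) => /=; field.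
have b2 i : b i * b i = b i by rewrite /b -natrM; case: splits.
(* As [b i] is 0 or 1, the diagonal of the squared sum is the sum itself; completing the
   off-diagonal part with it gives the factor 2. *)
have -> : \sum_(e in cut A) w a e = \sum_(i in a) b i * 2 -
    (\sum_(i in a) b i) * (\sum_(i in a) b i).
  rewrite sumw mulr_suml -!sumrB; apply: eq_bigr => i ia.
  by rewrite mulr_sumr (bigD1 i ia) /= b2; ring.
by rewrite -mulr_suml -tE; ring.
Qed.

(** The lifts of the cuts [side s] and the functionals [w a] pulled back along [proj] satisfy
    [correlation_slack_bound]; its [r.+1] becomes [g + 1]. *)
Lemma cut_complete_xc (g : R) :
  extension_complexity_at_most (@solution_polytope R (Cut l) K) g ->
  (3 / 2) ^+ n <= g + 1.
Proof.
case=> d [r [Q [[_ [proj projE]] [q [A [b [C [c QE]]]]] rg]]].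
pose side (s : {set 'I_n}) : {set K} :=
  [set x : V | match x with
    | None => false | Some (inl i) => i \in s | Some (inr _) => true end].
have sideP s : solution_polytope (Cut l) (indicator R (cut (side s))).
  exists 1%N, (fun=> 1), (fun=> indicator R (cut (side s))); split => //.
  - by rewrite big_ord1.
  - move=> _; exists (cut (side s)) => //; split.
      by apply/is_cutsetE; exists (side s).
    pose f (j : 'I_l) : {set V} := [set None; Some (inr j)].
    have f_inj : injective f.
      move=> i j fij; have : Some (inr i) \in f j by rewrite -fij !inE eqxx
        orbT.
      by rewrite !inE /= => /eqP[].
    rewrite -[leqLHS]card_ord -(card_imset _ f_inj); apply: subset_leq_card.
    apply/subsetP => _ /imsetP[j _ ->]; rewrite (@in_cut K).
    by rewrite (@edges_complete V) splits_pair !inE.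
  - by rewrite big_ord1 scale1r.
have exy s : exists y, Q y /\ proj *m y = indicator R (cut (side s)).
  by move: (sideP s); rewrite -projE => -[y Qy <-]; exists y.
pose y s := projT1 (boolp.cid (exy s)).
have Qy s : Q (y s) by case: (projT2 (boolp.cid (exy s))).
have py s : proj *m y s = indicator R (cut (side s)).
  by case: (projT2 (boolp.cid (exy s))).
have := @correlation_slack_bound R n d r q A b C c y
  (fun a => edge_row (G := K) (w a) *m proj).
have QP z : Q z <-> (forall i, (A *m z) i ord0 <= b i ord0) /\ C *m z = c.
  by rewrite QE.
move=> bound.
have {bound} : (3 ^ n <= r.+1 * 2 ^ n)%N.
  apply: bound.
  - by move=> s; have /QP[] := Qy s.
  - by move=> s; have /QP[] := Qy s.
  - move=> a z zA zC; rewrite -mulmxA; apply: (@edge_row_solution _ _ _ l).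
      by move=> S; rewrite sum_w_cut gerBl sqr_ge0.
    by rewrite -projE; exists z => //; apply/QP.
  - move=> a s; rewrite -mulmxA py edge_row_indicator sum_w_cut.
    congr (1 - (1 - _%:R) ^+ 2); rewrite /t; congr #|pred_of_set (_ :&: _)|.
    by apply/setP => i; rewrite inE splits_pair !inE.
rewrite -(ler_nat R) natrM !natrX -[r.+1%:R]natr1 => bound.
rewrite expr_div_n ler_pdivrMr ?exprn_gt0 //.
by apply: le_trans bound _; rewrite ler_wpM2r ?exprn_ge0 // lerD2r.
Qed.

End LowerBound.

(** * Exponential against polynomial growth *)

Lemma bernoulli (R : realFieldType) (u : R) (m : nat) :
  0 <= u -> 1 + m%:R * u <= (1 + u) ^+ m.
Proof.
move=> u0; elim: m => [|m IH]; first by rewrite mul0r addr0 expr0.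
rewrite exprSr; apply: (@le_trans _ _ ((1 + m%:R * u) * (1 + u))).
  have : 0 <= m%:R * (u * u) by rewrite mulr_ge0 // mulr_ge0.
  rewrite -natr1; nra.
by rewrite ler_wpM2r // addr_ge0.
Qed.

(** For [k = c.+1 * m], Bernoulli gives [(1 + u) ^+ k >= (1 + m%:R * u) ^+ c.+1]. The constant [D]
    makes [k.+1 <= D * (1 + m%:R * u)], so [c] of the factors absorb the polynomial, and [m] is
    chosen so that the last one exceeds [C * D ^+ c]. *)
Lemma exp_beats_poly (R : archiRealFieldType) (u C : R) (c K0 : nat) : 0 < u ->
  0 <= C ->
  exists2 k, (K0 <= k)%N & C * k.+1%:R ^+ c < (1 + u) ^+ k.
Proof.
move=> u0 C0; pose D := c.+1%:R / u + 1.
have D0 : 0 <= D by rewrite addr_ge0 // divr_ge0 // ltW.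
pose m := maxn K0 (Num.bound (C * D ^+ c / u)).
have mu0 : 0 < 1 + m%:R * u by rewrite ltr_pwDl // mulr_ge0 // ltW.
exists (c.+1 * m)%N; first by rewrite mulSn;
  apply: leq_trans (leq_maxl _ _) (leq_addr _ _).
rewrite mulnC exprM.
apply: (@lt_le_trans _ _ ((1 + m%:R * u) ^+ c.+1)); last first.
  apply: lerXn2r; rewrite ?nnegrE; first exact: ltW.
    by rewrite exprn_ge0 // addr_ge0 // ltW.
  exact: bernoulli (ltW u0).
rewrite exprS.
apply: (@le_lt_trans _ _ (C * D ^+ c * (1 + m%:R * u) ^+ c)).
  rewrite -mulrA -exprMn ler_wpM2l //; apply: lerXn2r; rewrite ?nnegrE //.
    by rewrite mulr_ge0 // ltW.
  have -> : D * (1 + m%:R * u) = c.+1%:R / u + 1 + c.+1%:R * m%:R + m%:R * u.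
    rewrite /D; field; exact: lt0r_neq0.
  rewrite -natr1 natrM [m%:R * c.+1%:R]mulrC.
  have := mulr_ge0 (ler0n R m) (ltW u0).
  have : 0 <= c.+1%:R / u by rewrite divr_ge0 // ltW.
  lra.
rewrite ltr_pM2r ?exprn_gt0 //; apply: ltr_pwDl => //.
rewrite -ler_pdivrMr //; apply: ltW; apply: lt_le_trans.
  by apply: archi_boundP; rewrite divr_ge0 ?(ltW u0) // mulr_ge0 // exprn_ge0.
by rewrite ler_nat leq_maxr.
Qed.

(** * Integral programs for cuts *)

Section Coupling.
Variables (R : realFieldType) (S1 S2 K1 K2 T : finType).
Variables (p1 : S1 -> R) (p2 : S2 -> R) (z : T -> R).
Variables (f1 : S1 -> K1) (f2 : S2 -> K2) (h1 : T -> K1) (h2 : T -> K2).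

Let m1 k := \sum_(t | h1 t == k) z t.
Let m2 k := \sum_(t | h2 t == k) z t.
Let w k1 k2 := \sum_(t | (h1 t == k1) && (h2 t == k2)) z t.

Hypotheses (p1_ge0 : forall s, 0 <= p1 s) (p2_ge0 : forall s, 0 <= p2 s).
Hypothesis z_ge0 : forall t, 0 <= z t.
Hypothesis m1E : forall k, m1 k = \sum_(s | f1 s == k) p1 s.
Hypothesis m2E : forall k, m2 k = \sum_(s | f2 s == k) p2 s.

(** A pair of keys is drawn with weight [w], then [s.1] and [s.2] independently, conditioned on
    their keys. Division by a zero marginal is harmless, since [w] vanishes there too. *)
Let q (s : S1 * S2) :=
  p1 s.1 * p2 s.2 * (w (f1 s.1) (f2 s.2) / (m1 (f1 s.1) * m2 (f2 s.2))).

Let w_ge0 k1 k2 : 0 <= w k1 k2. Proof. exact: sumr_ge0. Qed.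
Let m1_ge0 k : 0 <= m1 k. Proof. exact: sumr_ge0. Qed.
Let m2_ge0 k : 0 <= m2 k. Proof. exact: sumr_ge0. Qed.

Let sum_w_r k1 : \sum_k2 w k1 k2 = m1 k1.
Proof. by rewrite /m1 (partition_big h2 predT). Qed.

Let sum_w_l k2 : \sum_k1 w k1 k2 = m2 k2.
Proof.
rewrite /m2 (partition_big h1 predT) //=; apply: eq_bigr => k1 _.
by apply: eq_bigl => t; rewrite andbC.
Qed.

Let w_m1 k1 k2 : m1 k1 = 0 -> w k1 k2 = 0.
Proof.
move=> m0; apply/eqP; rewrite eq_le w_ge0 andbT -m0 -sum_w_r.
by rewrite (bigD1 k2) //= lerDl sumr_ge0.
Qed.

Let w_m2 k1 k2 : m2 k2 = 0 -> w k1 k2 = 0.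
Proof.
move=> m0; apply/eqP; rewrite eq_le w_ge0 andbT -m0 -sum_w_l.
by rewrite (bigD1 k1) //= lerDl sumr_ge0.
Qed.

Let sum_q_fiber2 s1 k2 :
  \sum_(s2 | f2 s2 == k2) q (s1, s2) = p1 s1 * (w (f1 s1) k2 / m1 (f1 s1)).
Proof.
rewrite (eq_bigr (fun s2 => p2 s2 *
    (p1 s1 * (w (f1 s1) k2 / (m1 (f1 s1) * m2 k2))))); last first.
  by move=> s2 /eqP<-; rewrite /q /=; ring.
rewrite -mulr_suml -m2E; have [m0|m0] := eqVneq (m2 k2) 0.
  by rewrite w_m2 // !mul0r !mulr0.
rewrite invfM mulrCA; congr (_ * _).
by rewrite mulrCA; congr (_ * _); rewrite mulrCA divff // mulr1.
Qed.

Let sum_q_fiber1 s2 k1 :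
  \sum_(s1 | f1 s1 == k1) q (s1, s2) = p2 s2 * (w k1 (f2 s2) / m2 (f2 s2)).
Proof.
rewrite (eq_bigr (fun s1 => p1 s1 *
    (p2 s2 * (w k1 (f2 s2) / (m1 k1 * m2 (f2 s2)))))); last first.
  by move=> s1 /eqP<-; rewrite /q /=; ring.
rewrite -mulr_suml -m1E; have [m0|m0] := eqVneq (m1 k1) 0.
  by rewrite w_m1 // !mul0r !mulr0.
rewrite invfM mulrCA; congr (_ * _).
by rewrite mulrCA; congr (_ * _); rewrite mulrA divff // mul1r.
Qed.

(** Marginals are stated as expectations of an arbitrary [g], the form in which the gluing of
    programs applies them to test values. *)
Lemma coupling : exists q : S1 * S2 -> R,
  [/\ forall s, 0 <= q s,
      forall g, \sum_s q s * g s.1 = \sum_s1 p1 s1 * g s1,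
      forall g, \sum_s q s * g s.2 = \sum_s2 p2 s2 * g s2,
      forall g, \sum_s q s * g (f1 s.1) (f2 s.2) = \sum_t z t * g (h1 t) (h2 t)
    & forall s, q s != 0 -> exists t, h1 t = f1 s.1 /\ h2 t = f2 s.2].
Proof.
exists q; split.
- by move=> s; rewrite !mulr_ge0 ?invr_ge0 ?mulr_ge0.
- move=> g; rewrite -(pair_bigA _ (fun s1 s2 => q (s1, s2) * g s1)) /=.
  apply: eq_bigr => s1 _; rewrite -mulr_suml; congr (_ * _).
  rewrite (partition_big f2 predT) //= (eq_bigr _ (fun k2 _ => sum_q_fiber2 s1
    k2)).
  rewrite -mulr_sumr -mulr_suml sum_w_r; have [m0|m0] := eqVneq (m1 (f1 s1)) 0.
    rewrite m0 mul0r mulr0; apply/esym/eqP; rewrite eq_le p1_ge0 andbT -m0 m1E.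
    by rewrite (bigD1 s1) //= lerDl sumr_ge0.
  by rewrite divff // mulr1.
- move=> g; rewrite -(pair_bigA _ (fun s1 s2 => q (s1, s2) * g s2)) /=
    exchange_big /=.
  apply: eq_bigr => s2 _; rewrite -mulr_suml; congr (_ * _).
  rewrite (partition_big f1 predT) //= (eq_bigr _ (fun k1 _ => sum_q_fiber1 s2
    k1)).
  rewrite -mulr_sumr -mulr_suml sum_w_l; have [m0|m0] := eqVneq (m2 (f2 s2)) 0.
    rewrite m0 mul0r mulr0; apply/esym/eqP; rewrite eq_le p2_ge0 andbT -m0 m2E.
    by rewrite (bigD1 s2) //= lerDl sumr_ge0.
  by rewrite divff // mulr1.
- move=> g; rewrite -(pair_bigA _ (fun s1 s2 => q (s1, s2) * g (f1 s1) (f2 s2)))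
    /=.
  have -> : \sum_t z t * g (h1 t) (h2 t) = \sum_k1 \sum_k2 w k1 k2 * g k1 k2.
    rewrite (partition_big h1 predT) //=; apply: eq_bigr => k1 _.
    rewrite (partition_big h2 predT) //=; apply: eq_bigr => k2 _.
    by rewrite mulr_suml; apply: eq_bigr => t /andP[/eqP-> /eqP->].
  rewrite (partition_big f1 predT) //=; apply: eq_bigr => k1 _.
  rewrite (eq_bigr (fun s1 => \sum_k2 p1 s1 * (w k1 k2 / m1 k1 * g k1 k2)));
    last first.
    move=> s1 /eqP <-; rewrite (partition_big f2 predT) //=.
    apply: eq_bigr => k2 _; rewrite mulrA -sum_q_fiber2 mulr_suml.
    by apply: eq_bigr => s2 /eqP<-.
  rewrite exchange_big /=; apply: eq_bigr => k2 _.
  rewrite -mulr_suml -m1E mulrA; congr (_ * _).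
  have [m0|m0] := eqVneq (m1 k1) 0; first by rewrite w_m1 // !mul0r mulr0.
  by rewrite mulrC divfK.
- move=> s; rewrite /q !mulf_eq0 !negb_or => /andP[_ /andP[w0 _]].
  have /existsP[t /andP[/eqP ? /eqP ?]] :
      [exists t, (h1 t == f1 s.1) && (h2 t == f2 s.2)].
    apply: contraNT w0 => /existsPn none; rewrite /w big1 // => t.
    by rewrite (negPf (none t)).
  by exists t.
Qed.

End Coupling.

Section StandardForm.
Variable R : realFieldType.

(** Equations are free, so a program in standard form costs one inequality per variable. *)
Record std_lp := StdLP {
  lp_var : finType;
  lp_eq : finType;
  lp_coef : lp_eq -> lp_var -> R;
  lp_rhs : lp_eq -> R }.

Definition lin (T : finType) (c z : T -> R) : R := \sum_t c t * z t.

Definition feasible (L : std_lp) (z : lp_var L -> R) : Prop :=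
  (forall t, 0 <= z t) /\ forall e, lin (lp_coef e) z = lp_rhs e.

Definition mixture (O J : Type) (v : O -> J -> R) (x : J -> R) : Prop :=
  exists (S : finType) (p : S -> R) (a : S -> O),
    [/\ forall s, 0 <= p s, \sum_s p s = 1
      & forall j, x j = \sum_s p s * v (a s) j].

(** Integrality relative to the linear observables [o]. The bound by 1 will make the feasible region
    a polytope. *)
Record describes (O J : Type) (v : O -> J -> R) (L : std_lp)
    (o : J -> lp_var L -> R) : Prop := Describes {
  describes_complete : forall w, exists2 z, feasible z & forall j, lin (o j) z =
    v w j;
  describes_sound : forall z, feasible z -> mixture v (fun j => lin (o j) z);
  describes_bounded : forall z : lp_var L -> R, feasible z -> forall t, z t <= 1
    }.

Lemma lin_sum3 (T1 T2 T3 : finType) (c z : T1 + (T2 + T3) -> R) :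
  lin c z = lin (fun t => c (inl t)) (fun t => z (inl t)) +
            (lin (fun t => c (inr (inl t))) (fun t => z (inr (inl t))) +
             lin (fun t => c (inr (inr t))) (fun t => z (inr (inr t)))).
Proof. by rewrite /lin !big_sumType. Qed.

Lemma lin0 (T : finType) (z : T -> R) : lin (fun=> 0) z = 0.
Proof. by rewrite /lin big1 // => t _; rewrite mul0r. Qed.

Lemma lin_opp (T : finType) (c z : T -> R) : lin (fun t => - c t) z = - lin c z.
Proof. by rewrite /lin -sumrN; apply: eq_bigr => t _; rewrite mulNr. Qed.

Lemma lin_delta (T : finType) (c : T -> R) (t0 : T) :
  lin c (fun t => (t == t0)%:R) = c t0.
Proof.
rewrite /lin (bigD1 t0) //= eqxx mulr1 big1 ?addr0 // => t /negPf->.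
by rewrite mulr0.
Qed.

Lemma lin_indicator (T : finType) (P : pred T) (z : T -> R) :
  lin (fun t => (P t)%:R) z = \sum_(t | P t) z t.
Proof.
rewrite /lin [RHS]big_mkcond /=; apply: eq_bigr => t _.
by case: (P t); rewrite ?mul1r ?mul0r.
Qed.

End StandardForm.

Lemma splits_agree (T : finType) (A A' U e : {set T}) :
  e \subset U -> A :&: U = A' :&: U -> splits A e = splits A' e.
Proof.
move=> eU AA'; have eA : e :&: A = e :&: A'.
  by rewrite -(setIidPl eU) -!setIA ![U :&: _]setIC AA'.
by rewrite /splits !(sameP setIidPl eqP) eA.
Qed.

Section CutProgram.
Variables (R : realFieldType) (V : finType) (k m : nat).
Implicit Types (A B D S U e : {set V}) (F : {set {set V}}).

Definition ncut F A : nat := #|[set e in F | splits A e]|.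

(** The first component of a left test allows queries about the whole root bag ([setT]), about its
    part in a neighbouring bag, or about the count alone ([set0]). *)
Definition test : Type := ({set V} * {set V} * nat + {set V})%type.

(* [inl (D, W, c)] tests for a cut of size c that induces W on the part D of
   the root bag B, and [inr e] for the edge e being cut. *)
Definition test_value B F A (j : test) : R :=
  match j with
  | inl (D, W, c) => ((A :&: B :&: D == W) && (ncut F A == c))%:R
  | inr e => ((e \in F) && splits A e)%:R
  end.

Lemma ncut_le F A : (ncut F A <= #|F|)%N.
Proof. by apply: subset_leq_card; apply/subsetP => e;
  rewrite inE => /andP[]. Qed.

Lemma ncut_agree F A A' U : (forall e, e \in F -> e \subset U) ->
  A :&: U = A' :&: U -> ncut F A = ncut F A'.
Proof.
move=> FU AA'; apply: eq_card => e; rewrite !inE; case eF: (e \in F) => //=.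
exact: splits_agree (FU e eF) AA'.
Qed.

Lemma ncutU F1 F2 A : [disjoint F1 & F2] ->
  ncut (F1 :|: F2) A = (ncut F1 A + ncut F2 A)%N.
Proof.
move=> dF; rewrite /ncut -[RHS]cardsUI [X in (_ + #|pred_of_set X|)%N](_ : _ =
  set0).
  by rewrite cards0 addn0; apply: eq_card => e; rewrite !inE andb_orl.
apply/setP => e; rewrite !inE; case eF: (e \in F1) => //=.
by rewrite (disjointFr dF eF) andbF.
Qed.

Lemma rdec_edges B U F N e : rdec k B U F N -> e \in F -> e \subset U.
Proof.
move=> d; elim: d e => {B U F N} [B F _ FB|B1 U1 F1 N1 B2 U2 F2 N2 _ IH1 _ IH2 _
  _] e.
  exact: FB.
rewrite inE => /orP[/IH1|/IH2] eU; apply: subset_trans eU _.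
  exact: subsetUl.
exact: subsetUr.
Qed.

(** The program is the simplex of distributions on the subsets of [B]; as [F] lives in [B], the
    trace on [B] decides every test. *)
Lemma bag_describes B F : (forall e, e \in F -> e \subset B) ->
  exists L (o : test -> lp_var L -> R),
    describes (test_value B F) o /\ #|lp_var L| = (2 ^ #|B|)%N.
Proof.
move=> FB; pose T : finType := {S : {set V} | S \in powerset B}.
pose L := @StdLP R T unit (fun _ _ => 1) (fun=> 1).
pose o (j : test) (t : lp_var L) : R := test_value B F (val t) j.
have TB (t : T) : val t :&: B = val t.
  by apply/setIidPl; rewrite -powersetE (valP t).
exists L, o; split; last by rewrite card_sig -[RHS]card_powerset;
  apply: eq_card.
split.
- move=> A; have AB : A :&: B \in powerset B by rewrite powersetE subsetIr.
  pose t0 : T := exist _ (A :&: B) AB.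
  exists (fun t : T => (t == t0)%:R).
    by split=> [t|[]]; rewrite ?ler0n // lin_delta.
  move=> j; rewrite lin_delta /o /=.
  case: j => [[[D W] c]|e] /=.
    rewrite -[A :&: B :&: B]setIA setIid (@ncut_agree F _ A B) //.
    by rewrite -setIA setIid.
  case eF: (e \in F) => //=; rewrite (@splits_agree _ _ A B) //;
    first exact: FB.
  by rewrite -setIA setIid.
- move=> z [z0 /(_ tt) z1]; exists T, z, val; split=> //.
    by rewrite -[RHS]z1; apply: eq_bigr => t _; rewrite mul1r.
  by move=> j; apply: eq_bigr => t _; rewrite mulrC.
- move=> z [z0 /(_ tt) z1] t; move: z1; rewrite /lin /= (bigD1 t) //= mul1r =>
    <-.
  by rewrite lerDl sumr_ge0 // => s _; rewrite mul1r.
Qed.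

Lemma glue_describes B1 U1 F1 L1 (o1 : test -> lp_var L1 -> R)
    B2 U2 F2 L2 (o2 : test -> lp_var L2 -> R) :
  B1 \subset U1 -> B2 \subset U2 ->
  (forall e, e \in F1 -> e \subset U1) -> (forall e, e \in F2 -> e \subset U2)
    ->
  U1 :&: U2 \subset B1 :&: B2 -> [disjoint F1 & F2] ->
  (#|F1| <= m)%N -> (#|F2| <= m)%N ->
  describes (test_value B1 F1) o1 -> describes (test_value B2 F2) o2 ->
  exists L (o : test -> lp_var L -> R),
    describes (test_value B1 (F1 :|: F2)) o /\
    #|lp_var L| = (#|lp_var L1| + (#|lp_var L2| + 2 ^ #|B1| * m.+1 * m.+1))%N.
Proof.
move=> sB1 sB2 FU1 FU2 sU dF Fm1 Fm2 d1 d2.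
(* A compatible pair of states is stored as one trace on [B1] and two counts: the second program is
   consulted only on [B2 :&: B1], which that trace determines. This keeps the dependence at
   [2 ^ #|B1|] instead of a product over two bags. *)
pose T3 : finType := ({S : {set V} | S \in powerset B1} * 'I_m.+1 *
  'I_m.+1)%type.
pose K : finType := ({set V} * 'I_m.+1)%type.
pose h1 (t : T3) : K := (val t.1.1, t.1.2).
pose h2 (t : T3) : K := (val t.1.1 :&: B2, t.2).
pose T : finType := (lp_var L1 + (lp_var L2 + T3))%type.
pose E : finType := (lp_eq L1 + (lp_eq L2 + (K + K)))%type.
pose coef (e : E) (t : T) : R := match e, t with
  | inl e, inl t => lp_coef e t
  | inr (inl e), inr (inl t) => lp_coef e t
  | inr (inr (inl x)), inl t => - o1 (inl (setT, x.1, nat_of_ord x.2)) t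
  | inr (inr (inl x)), inr (inr t) => (h1 t == x)%:R
  | inr (inr (inr x)), inr (inl t) => - o2 (inl (B1, x.1, nat_of_ord x.2)) t
  | inr (inr (inr x)), inr (inr t) => (h2 t == x)%:R
  | _, _ => 0 end.
pose rhs (e : E) : R := match e with
  | inl e => lp_rhs e | inr (inl e) => lp_rhs e | _ => 0 end.
pose L := StdLP coef rhs.
pose o (j : test) (t : lp_var L) : R := match j, t with
  | inl (D, W, c), inr (inr t) =>
      ((val t.1.1 :&: D == W) && (t.1.2 + t.2 == c)%N)%:R
  | inl _, _ => 0
  | inr e, inl t => o1 (inr e) t
  | inr e, inr (inl t) => o2 (inr e) t
  | inr e, inr (inr t) => 0 end.
have feasP (z : lp_var L -> R) : feasible z <->
  [/\ feasible (fun t => z (inl t)), feasible (fun t => z (inr (inl t))),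
      forall t, 0 <= z (inr (inr t)),
      forall x : K, \sum_(t | h1 t == x) z (inr (inr t)) =
        lin (o1 (inl (setT, x.1, nat_of_ord x.2))) (fun t => z (inl t))
    & forall x : K, \sum_(t | h2 t == x) z (inr (inr t)) =
        lin (o2 (inl (B1, x.1, nat_of_ord x.2))) (fun t => z (inr (inl t)))].
  split.
    move=> [z0 zE]; split.
    - split=> [t|e]; first exact: z0.
      by have := zE (inl e); rewrite lin_sum3 /= !lin0 !addr0.
    - split=> [t|e]; first exact: z0.
      by have := zE (inr (inl e)); rewrite lin_sum3 /= !lin0 add0r addr0.
    - by move=> t; apply: z0.
    - move=> x; have := zE (inr (inr (inl x))).
      rewrite lin_sum3 /= lin0 lin_opp (lin_indicator (fun t => h1 t == x))
        add0r.
      by rewrite addrC => /eqP; rewrite subr_eq0 => /eqP.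
    - move=> x; have := zE (inr (inr (inr x))).
      rewrite lin_sum3 /= lin0 lin_opp (lin_indicator (fun t => h2 t == x))
        add0r.
      by rewrite addrC => /eqP; rewrite subr_eq0 => /eqP.
  move=> [[z1 zE1] [z2 zE2] z3 zE3 zE4]; split; first by case=> [|[]].
  case=> [e|[e|[x|x]]]; rewrite lin_sum3 /=.
  - by rewrite !lin0 !addr0; apply: zE1.
  - by rewrite !lin0 add0r addr0; apply: zE2.
  - by rewrite lin0 lin_opp (lin_indicator (fun t => h1 t == x)) add0r zE3
      addNr.
  - by rewrite lin0 lin_opp (lin_indicator (fun t => h2 t == x)) add0r zE4
      addNr.
have ncutm1 A : (ncut F1 A < m.+1)%N by rewrite ltnS (leq_trans (ncut_le _ _)).
have ncutm2 A : (ncut F2 A < m.+1)%N by rewrite ltnS (leq_trans (ncut_le _ _)).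
pose g1 A : K := (A :&: B1, Ordinal (ncutm1 A)).
pose g2 A : K := (A :&: B2 :&: B1, Ordinal (ncutm2 A)).
have g1E A x : test_value B1 F1 A (inl (setT, x.1, nat_of_ord x.2)) = (g1 A ==
  x)%:R.
  by case: x => S c; rewrite /= setIT xpair_eqE.
have g2E A x : test_value B2 F2 A (inl (B1, x.1, nat_of_ord x.2)) = (g2 A ==
  x)%:R.
  by case: x => S c; rewrite /= xpair_eqE.
exists L, o; split; last first.
  rewrite !card_sum !card_prod card_sig !card_ord -card_powerset.
  by do 4!congr (_ + _)%N; congr (_ * _ * _)%N; apply: eq_card.
split.
- move=> A; have [z1 fz1 z1E] := describes_complete d1 A.
  have [z2 fz2 z2E] := describes_complete d2 A.
  have AB : A :&: B1 \in powerset B1 by rewrite powersetE subsetIr.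
  pose t0 : T3 := (exist _ (A :&: B1) AB, Ordinal (ncutm1 A), Ordinal (ncutm2
    A)).
  have h1t0 : h1 t0 = g1 A by [].
  have h2t0 : h2 t0 = g2 A by rewrite /h2 /g2 /= setIAC.
  exists (fun t : T => match t with
    | inl t => z1 t | inr (inl t) => z2 t | inr (inr t) => (t == t0)%:R end).
    apply/feasP; split=> //.
      by move=> x; rewrite z1E g1E -(lin_indicator (fun t => h1 t == x))
        lin_delta h1t0.
    by move=> x; rewrite z2E g2E -(lin_indicator (fun t => h2 t == x)) lin_delta
      h2t0.
  move=> [[[D W] c]|e]; rewrite lin_sum3 /=.
    by rewrite !lin0 !add0r lin_delta /= ncutU.
  rewrite lin0 addr0 z1E z2E /= inE andb_orl -natrD; congr _%:R.
  case eF1: (e \in F1) => //=; rewrite ?(disjointFr dF eF1) /=.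
  by rewrite addn0 orbF.
- move=> z /feasP[fz1 fz2 z3 zE1 zE2].
  have [S1 [p1 [a1 [p1_ge0 p1_sum p1E]]]] := describes_sound d1 fz1.
  have [S2 [p2 [a2 [p2_ge0 p2_sum p2E]]]] := describes_sound d2 fz2.
  have [||q [q0 q1 q2 q3 qs]] := @coupling R S1 S2 K K T3 p1 p2
    (fun t => z (inr (inr t))) (g1 \o a1) (g2 \o a2) h1 h2 p1_ge0 p2_ge0 z3.
  + move=> x; rewrite zE1 p1E [RHS]big_mkcond; apply: eq_bigr => s _.
    by rewrite g1E /=; case: eqP; rewrite ?mulr1 ?mulr0.
  + move=> x; rewrite zE2 p2E [RHS]big_mkcond; apply: eq_bigr => s _.
    by rewrite g2E /=; case: eqP; rewrite ?mulr1 ?mulr0.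
  (* Two coupled cuts are patched together. On the support of [q] their keys are compatible, so they
     agree on [B1 :&: B2], hence on [U1 :&: U2]. *)
  pose a s := (a1 s.1 :&: U1) :|: (a2 s.2 :&: U2).
  have aE s : q s != 0 -> (a s :&: U1 = a1 s.1 :&: U1) /\ (a s :&: U2 = a2 s.2
    :&: U2).
    move=> /qs[t [] /= ht1 ht2].
    have agree x : x \in U1 -> x \in U2 -> (x \in a1 s.1) = (x \in a2 s.2).
      move=> x1 x2; have : x \in B1 :&: B2 by apply: (subsetP sU);
        rewrite inE x1 x2.
      rewrite inE => /andP[xB1 xB2].
      have := congr1 (fun u : K => x \in u.1) ht2; rewrite /h2 /=.
      have := congr1 (fun u : K => u.1) ht1; rewrite /h1 /= => ->.
      by rewrite !inE xB1 xB2 !andbT.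
    split; apply/setP => x; rewrite !inE.
      case x1: (x \in U1); rewrite ?andbF //= !andbT.
      case x2: (x \in U2); rewrite ?andbF ?orbF // andbT.
      by rewrite (agree x x1 x2) orbb.
    case x2: (x \in U2); rewrite ?andbF //= !andbT.
    case x1: (x \in U1); rewrite ?andbF // andbT.
    by rewrite (agree x x1 x2) orbb.
  exists (S1 * S2)%type, q, a; split=> //.
    transitivity (\sum_s q s * 1); first by apply: eq_bigr => s _;
      rewrite mulr1.
    by rewrite (q1 (fun=> 1)) -[RHS]p1_sum; apply: eq_bigr => s _;
      rewrite mulr1.
  move=> [[[D W] c]|e]; rewrite lin_sum3 /=.
    pose g (x y : K) : R := ((x.1 :&: D == W) && (x.2 + y.2 == c)%N)%:R.
    rewrite !lin0 !add0r; transitivity (\sum_t z (inr (inr t)) * g (h1 t) (h2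
      t)).
      by rewrite /lin; apply: eq_bigr => t _; rewrite mulrC.
    rewrite -q3; apply: eq_bigr => s _.
    have [->|/aE[a1E a2E]] := eqVneq (q s) 0; first by rewrite !mul0r.
    have aB : a s :&: B1 = a1 s.1 :&: B1.
      by rewrite -(setIidPr sB1) !setIA a1E.
    congr (_ * _%:R); rewrite /= aB ncutU // (ncut_agree FU1 a1E).
    by rewrite (ncut_agree FU2 a2E).
  rewrite lin0 addr0 p1E p2E -q1 -q2 -big_split /=; apply: eq_bigr => s _.
  have [->|/aE[a1E a2E]] := eqVneq (q s) 0; first by rewrite !mul0r addr0.
  rewrite -mulrDr; congr (_ * _); rewrite inE andb_orl -natrD; congr _%:R.
  case eF1: (e \in F1); rewrite ?(disjointFr dF eF1) /=.
    by rewrite addn0 orbF (splits_agree (FU1 e eF1) a1E).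
  by case eF2: (e \in F2) => //=; rewrite (splits_agree (FU2 e eF2) a2E).
- move=> z /feasP[fz1 fz2 z3 zE1 zE2] [t|[t|t]].
  + exact: (describes_bounded d1 fz1).
  + exact: (describes_bounded d2 fz2).
  (* A new variable is at most its marginal, which is a mixture of 0/1 test values. *)
  + apply: (@le_trans _ _ (\sum_(t' | h1 t' == h1 t) z (inr (inr t')))).
      by rewrite (bigD1 t) //= lerDl sumr_ge0.
    have [S1 [p1 [a1 [p1_ge0 p1_sum p1E]]]] := describes_sound d1 fz1.
    rewrite zE1 p1E -p1_sum; apply: ler_sum => s _.
    by rewrite g1E ler_piMr // lern1 leq_b1.
Qed.

Lemma rdec_describes B U F N : rdec k B U F N -> (#|F| <= m)%N ->
  exists L (o : test -> lp_var L -> R),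
    describes (test_value B F) o /\ (#|lp_var L| <= N * (2 ^ k.+2 * m.+1 ^
      2))%N.
Proof.
pose X := (2 ^ k.+1 * m.+1 * m.+1)%N.
have -> : (2 ^ k.+2 * m.+1 ^ 2)%N = (2 * X)%N by rewrite /X expnS; lia.
(* The [N] leaves and [N - 1] gluings cost at most [X] each; the summand [X] makes this count
   inductive. *)
move=> d Fm; suff [L [o [dL cL]]] : exists L (o : test -> lp_var L -> R),
    describes (test_value B F) o /\ (#|lp_var L| + X <= N * (2 * X))%N.
  by exists L, o; split=> //; apply: leq_trans cL; apply: leq_addr.
have card_bag B0 U0 F0 N0 : rdec k B0 U0 F0 N0 -> (2 ^ #|B0| <= 2 ^ k.+1)%N.
  by move=> d0; rewrite leq_exp2l //; elim: d0.
elim: d Fm => {B U F N} [B F kB FB|B1 U1 F1 N1 B2 U2 F2 N2 d1 IH1 d2 IH2 sU dF]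
  Fm.
  have [L [o [dL cL]]] := bag_describes FB; exists L, o; split=> //.
  rewrite cL mul1n mul2n -addnn leq_add2r /X -mulnA.
  apply: leq_trans (card_bag _ _ _ _ (rdec_bag kB FB)) _.
  by rewrite leq_pmulr.
have Fm1 : (#|F1| <= m)%N by apply: leq_trans Fm;
  apply/subset_leq_card/subsetUl.
have Fm2 : (#|F2| <= m)%N by apply: leq_trans Fm;
  apply/subset_leq_card/subsetUr.
have [L1 [o1 [dL1 cL1]]] := IH1 Fm1; have [L2 [o2 [dL2 cL2]]] := IH2 Fm2.
have [L [o [dL cL]]] := glue_describes (rdec_root d1) (rdec_root d2)
  (fun e => rdec_edges d1) (fun e => rdec_edges d2) sU dF Fm1 Fm2 dL1 dL2.
exists L, o; split=> //; rewrite cL mulnDl.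
have : (2 ^ #|B1| * m.+1 * m.+1 <= X)%N.
  by rewrite /X !leq_mul2r (card_bag _ _ _ _ d1) !orbT.
lia.
Qed.

End CutProgram.

(** * From programs to extension complexity *)

Lemma std_lp_xc (R : realType) (L : std_lp R) (M : nat)
    (W : 'I_M -> lp_var L -> R) (P : classical_sets.set 'cV[R]_M) (g : R) :
  (forall z : lp_var L -> R, feasible z -> forall t, z t <= 1) ->
  (forall z, feasible z -> P (\col_j lin (W j) z)) ->
  (forall x, P x -> exists2 z, feasible z & x = \col_j lin (W j) z) ->
  #|lp_var L|%:R <= g -> extension_complexity_at_most P g.
Proof.
move=> bound sound complete cardg.
pose d := #|lp_var L|.
pose un (y : 'cV[R]_d) (t : lp_var L) : R := y (enum_rank t) ord0.
pose Ceq : 'M[R]_(#|lp_eq L|, d) := \matrix_(e, i) lp_coef (enum_val e)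
  (enum_val i).
pose ceq : 'cV[R]_#|lp_eq L| := \col_e lp_rhs (enum_val e).
pose Q : classical_sets.set 'cV[R]_d := fun y =>
  (forall i, (- 1%:M *m y) i ord0 <= (0 : 'cV[R]_d) i ord0) /\ Ceq *m y = ceq.
have linE (c : lp_var L -> R) (y : 'cV[R]_d) :
    \sum_i c (enum_val i) * y i ord0 = lin c (un y).
  rewrite /lin (reindex (@enum_rank (lp_var L))) /=; last first.
    by apply: onW_bij; apply: enum_rank_bij.
  by apply: eq_bigr => t _; rewrite enum_rankK.
have QP y : Q y <-> feasible (un y).
  split=> [[y0 yE]|[y0 yE]]; split.
  - by move=> t; have := y0 (enum_rank t); rewrite mulNmx mul1mx !mxE oppr_le0.
  - move=> e; have /matrixP/(_ (enum_rank e) ord0) := yE.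
    by rewrite !mxE enum_rankK -linE => <-; apply: eq_bigr => i _;
      rewrite !mxE enum_rankK.
  - move=> i; rewrite mulNmx mul1mx !mxE oppr_le0.
    by have := y0 (enum_val i); rewrite /un enum_valK.
  - apply/matrixP => e j; rewrite ord1 !mxE -yE -linE.
    by apply: eq_bigr => i _; rewrite !mxE.
exists d, d, Q; split=> //; last first.
  by exists #|lp_eq L|, (- 1%:M), 0, Ceq, ceq.
split.
  exists 1 => y /QP fy i; have := bound _ fy (enum_val i); have [y0 _] := fy.
  by have := y0 (enum_val i); rewrite /un enum_valK => yi; rewrite ger0_norm.
pose proj : 'M[R]_(M, d) := \matrix_(j, i) W j (enum_val i).
have projE y : proj *m y = \col_j lin (W j) (un y).
  apply/matrixP => j i; rewrite ord1 !mxE -linE.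
  by apply: eq_bigr => t _; rewrite !mxE.
exists proj; apply/boolp.funext => x; apply/boolp.propext; split.
  by move=> [y /QP fy <-]; rewrite projE; apply: sound.
move=> /complete[z fz ->]; pose y : 'cV[R]_d := \col_i z (enum_val i).
have yz : un y = z by apply/boolp.funext => t; rewrite /un mxE enum_rankK.
by exists y; [apply/QP; rewrite yz | rewrite projE yz].
Qed.

(** Graphs without edges are treated apart, because the polynomial bound is 0 for [n = 0]. The
    equation with right-hand side [c] is consistent exactly when [P] is nonempty. *)
Lemma dim0_xc (R : realType) (m : nat) (P : classical_sets.set 'cV[R]_m) (g : R)
  :
  m = 0%N -> 0 <= g -> extension_complexity_at_most P g.
Proof.
move=> m0; move: P; rewrite m0 => P g0.
pose c : 'cV[R]_1 := if boolp.asbool (P 0) then 0 else const_mx 1.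
pose Q : classical_sets.set 'cV[R]_0 := fun y =>
  (forall i, ((0 : 'M[R]_(0, 0)) *m y) i ord0 <= (0 : 'cV[R]_0) i ord0) /\
  (0 : 'M[R]_(1, 0)) *m y = c.
have v0 (y : 'cV[R]_0) : y = 0 by apply/matrixP => -[].
have QP y : Q y <-> P y.
  rewrite (v0 y) /Q !mul0mx /c; split.
    case=> _; case: boolp.asboolP => // _ /matrixP/(_ ord0 ord0)/eqP.
    by rewrite !mxE eq_sym oner_eq0.
  by move=> P0; split=> [[]//|]; rewrite boolp.asboolT.
exists 0%N, 0%N, Q; split=> //; last by exists 1%N, 0, 0, 0, c.
split; first by exists 0 => y _ [].
exists 0; apply/boolp.funext => x; apply/boolp.propext; split.
  by move=> [y /QP Py <-]; rewrite (v0 (_ *m _)) -(v0 y).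
by move=> Px; exists x; [apply/QP | rewrite (v0 x) (v0 (_ *m _))].
Qed.

(** The size condition is imposed by free equations: each count below [l] gets probability 0. *)
Lemma Cut_xc (R : realType) (G : sgraph) (k l : nat) (g : R) :
  treewidth_at_most G k ->
  (#|G|.+1 * (2 ^ k.+2 * #|edges G|.+1 ^ 2))%:R <= g ->
  extension_complexity_at_most (@solution_polytope R (Cut l) G) g.
Proof.
move=> /treewidth_rdec[B [N [dec Nn]]] gb.
have [L [o [dL cL]]] := rdec_describes R dec (leqnn #|edges G|).
pose coef (e : lp_eq L + 'I_l) : lp_var L -> R := match e with
  | inl e => lp_coef e | inr c => o (inl (set0, set0, nat_of_ord c)) end.
pose rhs (e : lp_eq L + 'I_l) : R := if e is inl e then lp_rhs e else 0.
pose L' := @StdLP R (lp_var L) (lp_eq L + 'I_l)%type coef rhs.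
have feas' (z : lp_var L' -> R) : feasible z <->
    @feasible R L z /\ forall c : 'I_l, lin (o (inl (set0, set0, nat_of_ord c)))
      z = 0.
  split=> [[z0 zE]|[[z0 zE] zl]].
    split; first by split=> // e; apply: (zE (inl e)).
    by move=> c; apply: (zE (inr c)).
  by split=> // -[e|c]; [apply: zE | apply: zl].
have countE A c : test_value R B (edges G) A (inl (set0, set0, c)) =
    (#|cut A| == c)%:R by rewrite /= setI0 eqxx.
have edgeE A e : test_value R B (edges G) A (inr e) = (e \in cut A)%:R.
  by rewrite in_cut.
apply: (@std_lp_xc R L' _ (fun j => o (inr (enum_val j)))).
- by move=> z /feas'[fz _]; apply: describes_bounded dL z fz.
- move=> z /feas'[fz zl].
  have [S [p [a [p0 p1 pE]]]] := describes_sound dL fz.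
  have pl s : p s != 0 -> (l <= #|cut (a s)|)%N.
    apply: contraNT; rewrite -ltnNge => ltl.
    have := zl (Ordinal ltl); rewrite pE /= => /eqP.
    rewrite psumr_eq0 => [|s' _]; last by rewrite mulr_ge0 // ler0n.
    move/allP/(_ s); rewrite mem_index_enum => /(_ isT) /=.
    by rewrite setI0 eqxx /ncut /= -/(cut (a s)) eqxx mulr1.
  (* Cuts of weight 0 may be smaller than [l], so only the support enters the convex combination. *)
  pose supp := [set s | p s != 0].
  exists #|supp|, (fun i => p (enum_val i)),
    (fun i => indicator R (cut (a (enum_val i)))); split.
  + by move=> i.
  + rewrite -(big_enum_val p) -[RHS]p1 [LHS]big_mkcond; apply: eq_bigr => s _.
    by rewrite inE; have [->|] := eqVneq (p s) 0.
  + move=> i; exists (cut (a (enum_val i))) => //; split.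
      by apply/is_cutsetE; exists (a (enum_val i)).
    by apply: pl; have := enum_valP i; rewrite inE.
  + rewrite -(big_enum_val (fun s => p s *: indicator R (cut (a s)))).
    apply/matrixP => j i; rewrite ord1 !mxE summxE pE [RHS]big_mkcond.
    apply: eq_bigr => s _; rewrite edgeE !mxE [s \in supp]inE.
    by have [->|] := eqVneq (p s) 0; rewrite ?mul0r.
- move=> x [n [w [p [w0 w1 pS ->]]]].
  have exz i : exists z, [/\ feasible (L := L') z &
      p i = \col_j lin (o (inr (enum_val j))) z].
    have [X [/is_cutsetE[A ->] lA] ->] := pS i.
    have [z fz zE] := describes_complete dL A; exists z; split.
      apply/feas'; split=> // c; rewrite zE countE.
      by case: eqP => // cA; move: lA; rewrite cA leqNgt ltn_ord.
    by apply/matrixP => j i'; rewrite !mxE zE edgeE.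
  pose z i := projT1 (boolp.cid (exz i)).
  have zP i : feasible (L := L') (z i) /\ p i = \col_j lin (o (inr (enum_val
    j))) (z i).
    by have [] := projT2 (boolp.cid (exz i)).
  have linE c : lin c (fun t => \sum_i w i * z i t) = \sum_i w i * lin c (z i).
    rewrite /lin (eq_bigr (fun t => \sum_i w i * (c t * z i t))).
      by rewrite exchange_big /=; apply: eq_bigr => i _; rewrite mulr_sumr.
    by move=> t _; rewrite mulr_sumr; apply: eq_bigr => i _; rewrite mulrCA.
  exists (fun t => \sum_i w i * z i t).
    split=> [t|e].
      by apply: sumr_ge0 => i _; have [[zi0 _] _] := zP i; apply: mulr_ge0.
    rewrite linE -[RHS]mul1r -w1 mulr_suml; apply: eq_bigr => i _.
    by have [[_ ziE] _] := zP i; rewrite ziE.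
  apply/matrixP => j i; rewrite summxE !mxE linE; apply: eq_bigr => i' _.
  by have [_ pE] := zP i'; rewrite mxE pE mxE.
- apply: le_trans gb; rewrite ler_nat; apply: leq_trans cL _.
  by rewrite leq_mul2r Nn orbT.
Qed.

Lemma card_edges (G : sgraph) : (#|edges G| <= #|G| ^ 2)%N.
Proof.
rewrite -mulnn -card_prod.
apply: leq_trans (leq_imset_card (fun p : G * G => [set p.1; p.2]) predT).
apply: subset_leq_card; apply/subsetP => e;
  rewrite [e \in edges G]inE => /existsP[x /existsP[y /andP[_ /eqP->]]].
by apply/imsetP; exists (x, y).
Qed.

Lemma no_edges (G : sgraph) : (#|G| <= 1)%N -> #|edges G| = 0%N.
Proof.
move=> G1; apply/eqP; rewrite cards_eq0; apply/eqP/setP => e.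
rewrite in_set0; apply/negP; rewrite [e \in _]inE.
move=> /existsP[x /existsP[y /andP[]]].
by rewrite (card_le1_eqP G1 x y) // adj_irr.
Qed.

Lemma Cut_extension_complexity (R : realType) (l : nat) :
  has_extension_complexity (Cut l) (fun k n : nat => 2 ^+ k * n%:R ^+ 10 : R).
Proof.
move=> k _ G <- twG; have [G1|G2] := leqP #|G| 1.
  apply: dim0_xc; first exact: no_edges.
  by rewrite mulr_ge0 // exprn_ge0.
apply: (Cut_xc _ twG); rewrite -!natrX -natrM ler_nat.
have := card_edges G; move: #|edges G| #|G| G2 => m n n2 mn.
have m3 : (m.+1 <= n ^ 3)%N by rewrite !expnS expn0 in mn *; nia.
have n1 : (n.+1 <= n ^ 2)%N by rewrite !expnS expn0; nia.
have n4 : (4 <= n ^ 2)%N by rewrite !expnS expn0; nia.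
(* The three factors bound [n.+1], the 4 in [2 ^ k.+2], and [m.+1 ^ 2]. *)
have -> : (n ^ 10 = n ^ 2 * (n ^ 2 * (n ^ 3) ^ 2))%N by rewrite -expnM -!expnD.
rewrite -[k.+2]addn2 expnD -mulnA mulnCA leq_mul2l; apply/orP; right.
by rewrite !leq_mul // leq_exp2r.
Qed.

(* Subexponential bounds and conclusion *)
From mathcomp Require Import all_classical all_reals all_analysis.
Import numFieldNormedType.Exports.

(** Eventually [f k <= k / 4], and 2 is below the fourth power of 5/4, so the exponential is at most
    [(5 / 4) ^+ k]. Since 3/2 is 5/4 times 6/5, the factor [(6 / 5) ^+ k] remains to absorb the
    polynomial, the added 1 and the shift by [l]. *)
Lemma subexponential_lt (R : realType) (f : nat -> R) (l c : nat) :
  (f k / k%:R @[k --> \oo] --> (0 : R))%classic ->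
  exists n : nat,
    2 `^ f (n + l)%N * (n + l).+1%:R ^+ c + 1 < (3 / 2 : R) ^+ n.
Proof.
move=> f0.
have [K0 _ fK] : (\forall k \near \oo, f k <= k%:R / 4)%classic.
  have /cvgrPdist_le /(_ (1 / 4)) := f0.
  have q0 : 0 < 1 / 4 :> R by lra.
  move=> /(_ q0) H; near=> k.
  have k0 : 0 < k%:R :> R by rewrite ltr0n; near: k; exact: nbhs_infty_gt.
  have : `|0 - f k / k%:R| <= 1 / 4 by near: k.
  rewrite sub0r normrN => /(le_trans (ler_norm _)).
  by rewrite ler_pdivrMr // mul1r mulrC.
have u0 : 0 < 1 / 5 :> R by lra.
have C0 : 0 <= 2 * (3 / 2) ^+ l :> R by rewrite mulr_ge0 // exprn_ge0.
have [k Kk kC] := @exp_beats_poly R (1 / 5) (2 * (3 / 2) ^+ l) c (maxn K0 l) u0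
  C0.
have lk : (l <= k)%N by apply: leq_trans Kk; exact: leq_maxr.
exists (k - l)%N; rewrite subnK //.
have fk : f k <= k%:R / 4 by apply: fK; apply: leq_trans Kk; exact: leq_maxl.
have p54 : 2 `^ f k <= (5 / 4 : R) ^+ k.
  apply: (@le_trans _ _ (2 `^ (k%:R / 4))); first by rewrite ler_powR // ler1n.
  have -> : k%:R / 4 = 4^-1 * k%:R :> R by rewrite mulrC.
  rewrite powRrM powR_mulrn ?powR_ge0 //; apply: lerXn2r;
    rewrite ?nnegrE ?powR_ge0 //.
  rewrite -(@ler_pXn2r _ 4) ?nnegrE ?powR_ge0 //.
  rewrite -powR_mulrn ?powR_ge0 // -powRrM mulVf // powRr1 //.
  lra.
have k1 : 1 <= (5 / 4 : R) ^+ k * k.+1%:R ^+ c.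
  rewrite -[leLHS]mulr1; apply: ler_pM => //; first by apply: exprn_ege1; lra.
  by apply: exprn_ege1; rewrite ler1n.
apply: (@le_lt_trans _ _ (2 * ((5 / 4 : R) ^+ k * k.+1%:R ^+ c))).
  rewrite mulr_natl mulr2n; apply: lerD => //;
    rewrite ler_wpM2r // exprn_ge0 //.
rewrite -(@ltr_pM2r _ ((3 / 2) ^+ l)) ?exprn_gt0 // -exprD subnK //.
have -> : (3 / 2 : R) ^+ k = (5 / 4) ^+ k * (1 + 1 / 5) ^+ k.
  by rewrite -exprMn; congr (_ ^+ _); field.
have -> : 2 * ((5 / 4) ^+ k * k.+1%:R ^+ c) * (3 / 2) ^+ l =
  (5 / 4) ^+ k * (2 * (3 / 2) ^+ l * k.+1%:R ^+ c) :> R by ring.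
by rewrite ltr_pM2l // exprn_gt0.
Unshelve. all: by end_near.
Qed.

(** A complete graph on [k.+1] vertices has treewidth at most [k], so a bound exponential in its
    order is exponential in [k]. *)
Lemma Cut_no_extended_formulation (R : realType) (l c : nat) (f : nat -> R) :
  (f k / k%:R @[k --> \oo] --> (0 : R))%classic ->
  has_no_extended_formulation (Cut l) (fun k n : nat => 2 `^ f k * n%:R ^+ c :
    R).
Proof.
move=> /(subexponential_lt l c)[n nlt].
have cardV : #|{: option ('I_n + 'I_l)}| = (n + l).+1.
  by rewrite card_option card_sum !card_ord.
exists (n + l)%N, (n + l).+1, (complete_graph (option ('I_n + 'I_l)));
  split => //.
  by apply: treewidth_trivial; rewrite cardV.
by move=> /cut_complete_xc; rewrite leNgt nlt.
Qed.

Unset Implicit Arguments.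
Local Open Scope classical_set_scope.

Theorem theorem6p7 (R : realType) :
  (exists c : nat, forall l : nat,
     has_extension_complexity (Cut l)
       (fun k n : nat => 2 ^+ k * n%:R ^+ c : R))
  /\
  (ETH R ->
   forall (l c : nat) (f : nat -> R),
     (f k / k%:R @[k --> \oo] --> (0 : R)) ->
     has_no_extended_formulation (Cut l)
       (fun k n : nat => 2 `^ f k * n%:R ^+ c : R)).
Proof.
split; first by exists 10%N => l; apply: Cut_extension_complexity.
by move=> _ l c f; apply: Cut_no_extended_formulation.
Qed.
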